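(* Let $(X,\theta,\mu,\alpha)$ be a Gibbs-Markov map with full branches and $\theta$-invariant probability $\mu$, and let $(Y,T,\kappa)$ be a topologically transitive extension of it by a graph $\mathcal{G}=(\mathbf{V},\mathbf{E})$. Then $R(T)\le\rho(\widehat{T})\le1$. If $(Y,T,\mu)$ is symmetric, then $\rho(\widehat{T})=R(T)$.
   Context: Markov map. $(X,\theta,\mu,\alpha)$ consists of a standard probability space $(X,\mathcal{B},\mu)$, an at most countable partition $\alpha$ of $X$ into measurable sets of positive measure, and $\theta:X\to X$ such that for all $a,b\in\alpha$: $\theta|_a:a\to\theta(a)$ is invertible, bimeasurable and non-singular; and either $\mu(a\cap\theta(b))=0$ or $\mu(a\cap\theta(b)^c)=0$; moreover the sets $[w_1\ldots w_n]=\bigcap_{k=1}^n\theta^{-k+1}(w_k)$, $w_i\in\alpha$, $n\ge1$, generate $\mathcal{B}$ mod $\mu$. $\mathcal{W}^1=\alpha$; $\mathcal{W}^n$ is the set of admissible words $w=(w_1\ldots w_n)$, $w_i\in\alpha$, i.e. $\theta(w_i)\supset w_{i+1}$ (mod $\mu$); $\mathcal{W}^\infty=\bigcup_{n\ge1}\mathcal{W}^n$. For $w\in\mathcal{W}^n$, $\tau_w:\theta^n([w])\to[w]$ is the inverse of $\theta^n|_{[w]}$ and $\varphi_w=\frac{d\mu\circ\tau_w}{d\mu}$. It is a Gibbs-Markov map with full branches if $\theta([w])=X$ mod $\mu$ for all $w\in\mathcal{W}^1$ and there are $C>0$, $r\in(0,1)$ with $|\log\varphi_w(x)-\log\varphi_w(y)|\le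 C\,d_r(x,y)$ for all $w\in\mathcal{W}^\infty$ and a.e. $x,y\in X$, where $d_r(x,y)=r^{\min\{i:x_i\ne y_i\}}$ and $(x_i),(y_i)$ are the itineraries of $x,y$ with respect to $\alpha$. Graph extension. A graph is directed, $\mathbf{V}$ at most countable, $\mathbf{E}\subset\mathbf{V}\times\mathbf{V}$. $\kappa:X\times\mathbf{V}\to\mathbf{V}$ is a nearest neighbour cocycle: each $\kappa_x$ is a bijection of $\mathbf{V}$, $(g,\kappa_x(g))\in\mathbf{E}$, and $\kappa_x$ is constant for $x$ in an element of $\alpha$. $Y=X\times\mathbf{V}$, $T(x,g)=(\theta(x),\kappa_x(g))$, $\kappa_x^n=\kappa_{\theta^{n-1}(x)}\circ\cdots\circ\kappa_x$. $m_{\mathbf{V}}$ is counting measure on $\mathbf{V}$. $T$ is topologically transitive if for all $a,b\in\alpha$, $g,h\in\mathbf{V}$ there is $k\ge1$ with $(\mu\otimes m_{\mathbf{V}})(T^k(a\times\{g\})\cap(b\times\{h\}))>0$. $R(T)=\limsup_{n\to\infty}\sqrt[n]{\mu(\{x\in X:\kappa_x^n(\mathbf{o})=\mathbf{o}\})}$ for $\mathbf{o}\in\mathbf{V}$; by topological transitivity this does not depend on $\mathbf{o}$. $\widehat{T}$ is the transfer operator of $T$ with respect to $\mu\otimes m_{\mathbf{V}}$, explicitly $\widehat{T}(f)(x,g)=\sum_{w\in\mathcal{W}^1}\varphi_w(x)f(\tau_w(x),\kappa_w^{-1}(g))$, where $\kappa_w=\kappa_y$ for $y\in[w]$. $\mathcal{H}_\infty$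 is the Banach space of measurable $f:Y\to\mathbb{R}$ with $\llbracket f\rrbracket_\infty=\big(\sum_{g\in\mathbf{V}}\|f(\cdot,g)\|_\infty^2\big)^{1/2}<\infty$ ($\|\cdot\|_\infty$ the $L^\infty(X,\mu)$-norm); $\widehat{T}$ acts on it as a bounded operator and $\rho(\widehat{T})=\lim_k\|\widehat{T}^k\|^{1/k}$ is its spectral radius on $\mathcal{H}_\infty$. $(Y,T,\mu)$ is symmetric if there are sequences $(C_n)$, $(N_n)$ with $\lim_n C_n^{1/n}=1$, $\lim_n N_n/n=0$ and, for all $v,w\in\mathbf{V}$ and $n\in\mathbb{N}$, $\mu(\{x\in X:\kappa_x^n(v)=w\})\le C_n\sum_{k=n-N_n}^{n+N_n}\mu(\{x\in X:\kappa_x^k(w)=v\})$. *)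

(* Defs.v *)
From HB Require Import structures.
From mathcomp Require Import all_boot all_order all_algebra.
From mathcomp Require Import all_classical all_reals all_analysis.

Set Implicit Arguments.
Unset Strict Implicit.
Unset Printing Implicit Defensive.
Import Order.TTheory GRing.Theory Num.Theory.
Import numFieldNormedType.Exports.

Local Open Scope classical_set_scope.
Local Open Scope ring_scope.
Local Open Scope ereal_scope.

(* A standard probability space is a probability on a standard Borel space: the
   sigma-algebra is the Borel sigma-algebra of a complete separable metric
   (Polish) topology, transported here along the bijection h. *)
Definition standard_borel (R : realType) d (X : measurableType d) : Prop :=
  exists (P : completePseudoMetricType R) (h : X -> P),
    [/\ hausdorff_space P,
        exists2 D : set P, countable D & dense D,
        bijective h
      & @measurable d X = preimage_set_system setT h (<<s (@open P) >>)].

Section Markov.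
Context (R : realType) d (X : measurableType d) (mu : probability X R).
(* The partition alpha is the family of cells indexed by the letters in I. *)
Context (I : countType) (cell : I -> set X) (theta : X -> X).

(* cyl [:: w_1; ...; w_n] = \bigcap_k theta^{-k+1}(w_k). *)
Fixpoint cyl (w : seq I) : set X :=
  if w is i :: w' then cell i `&` theta @^-1` cyl w' else setT.

Record markov_map : Prop := MarkovMap {
  cell_measurable : forall a, measurable (cell a) ;
  cell_gt0 : forall a, 0 < mu (cell a) ;
  cell_disjoint : trivIset setT cell ;
  cell_cover : \bigcup_a cell a = setT ;
  theta_inj : forall a, {in cell a &, injective theta} ;
  theta_measurable : forall a, measurable_fun (cell a) theta ;
  theta_image_measurable : forall a (B : set X),
    measurable B -> B `<=` cell a -> measurable (theta @` B) ;
  theta_nonsingular : forall a (B : set X),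
    measurable B -> B `<=` cell a -> mu B = 0 <-> mu (theta @` B) = 0 ;
  theta_markov : forall a b,
    mu (cell a `&` theta @` cell b) = 0 \/
    mu (cell a `&` ~` (theta @` cell b)) = 0 ;
  cyl_generates : forall B : set X, measurable B ->
    exists2 B', <<s [set cyl w | w in [set w | w != [::]]] >> B' &
                mu (B `+` B') = 0
}.

(* W^infty: nonempty words with theta(w_i) containing w_{i+1} mod mu. *)
Definition admissible (w : seq I) : bool :=
  (w != [::]) &&
  sorted (fun a b => `[< mu (cell b `\` theta @` cell a) = 0 >]) w.

(* The inverse of theta^n : [w] -> theta^n [w]; it is the identity off
   theta^n [w]. *)
Definition tau (w : seq I) : X -> X := 'pinv_id (cyl w) (iter (size w) theta).

(* f is a version of d(mu o tau_w)/d(mu) on theta^n [w]. *)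
Definition is_jacobian (w : seq I) (f : X -> R) : Prop :=
  [/\ measurable_fun setT f,
      forall x, (0 <= f x)%R
    & forall B : set X, measurable B -> B `<=` iter (size w) theta @` cyl w ->
        mu (tau w @` B) = \int[mu]_(x in B) (f x)%:E].

Definition distinct_cells (x y : X) (k : nat) : bool :=
  `[< ~ exists i, cell i (iter k theta x) /\ cell i (iter k theta y) >].

(* Itineraries are indexed from 1, i.e. x_k is the cell of theta^{k-1}(x); the
   distance is 0 when the itineraries coincide. *)
Definition d_itin (r : R) (x y : X) : R :=
  if pselect (exists k, distinct_cells x y k) is left h then r ^+ (ex_minn h).+1
  else 0.

Definition full_branches : Prop :=
  forall a, mu (~` (theta @` cell a)) = 0.

Definition gibbs_property (phi : seq I -> X -> R) : Prop :=
  exists C r : R, [/\ (0 < C)%R, (0 < r < 1)%R &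
    forall w, admissible w ->
      \forall x \ae mu, \forall y \ae mu,
        (`| ln (phi w x) - ln (phi w y) | <= C * d_itin r x y)%R].

Record gibbs_markov_full (phi : seq I -> X -> R) : Prop := GibbsMarkovFull {
  gm_markov : markov_map ;
  gm_jacobian : forall w, admissible w -> is_jacobian w (phi w) ;
  gm_full : full_branches ;
  gm_gibbs : gibbs_property phi
}.

Definition invariant_measure : Prop :=
  forall B : set X, measurable B -> mu (theta @^-1` B) = mu B.

Section Extension.
Context (V : countType) (kappa : X -> V -> V).

Record nn_cocycle (E : V -> V -> Prop) : Prop := NNCocycle {
  kappa_bij : forall x, bijective (kappa x) ;
  kappa_edge : forall x g, E g (kappa x g) ;
  kappa_const : forall a x y, cell a x -> cell a y -> kappa x = kappa y
}.

Definition extension (z : X * V) : X * V := (theta z.1, kappa z.1 z.2).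

Fixpoint kappan (n : nat) (x : X) (g : V) : V :=
  if n is m.+1 then kappa (iter m theta x) (kappan m x g) else g.

(* mu (x) (counting measure on V): this is product_measure1 with V carrying the
   discrete sigma-algebra. *)
Definition mu_counting (A : set (X * V)) : \bar R :=
  \int[mu]_x counting (xsection A x).

Definition top_transitive : Prop :=
  forall (a b : I) (g h : V), exists2 k : nat, (0 < k)%N &
    0 < mu_counting ((iter k extension @` (cell a `*` [set g])) `&`
                     (cell b `*` [set h])).

Definition return_rate (o : V) : \bar R :=
  limn_esup (fun n => mu [set x | kappan n x o = o] `^ (n%:R^-1)).

(* Sums over k < 0 contribute nothing: n - N n is truncated. *)
Definition symmetric_extension : Prop :=
  exists (C : nat -> R) (N : nat -> nat),
    [/\ forall n, (0 <= C n)%R,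
        (C n `^ (n%:R^-1) : R)%R @[n --> \oo] --> (1 : R)%R,
        ((N n)%:R / n%:R : R)%R @[n --> \oo] --> (0 : R)%R
      & forall (v w : V) (n : nat),
          mu [set x | kappan n x v = w] <=
          (C n)%:E *
          \sum_(n - N n <= k < (n + N n).+1) mu [set x | kappan k x w = v]].

(* The common value kappa_w of kappa on the cell of the letter w. *)
Definition kappa_letter (i : I) (g : V) : V :=
  xget g [set kappa y g | y in cell i].

(* Sum of an absolutely summable real family. *)
Definition rsum (f : I -> R) : R :=
  fine (\esum_(i in setT) (EFin \o f)^\+ i - \esum_(i in setT) (EFin \o f)^\- i).

Definition transfer (phi : seq I -> X -> R) (f : X * V -> R) (z : X * V) : R :=
  rsum (fun i => phi [:: i] z.1 *
          f (tau [:: i] z.1, 'pinv_id setT (kappa_letter i) z.2))%R.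

(* The norm of H_infty. *)
Definition Hnorm (f : X * V -> R) : \bar R :=
  (\esum_(g in [set: V]) Lnorm mu +oo (fun x => (f (x, g))%:E) ^+ 2) `^ (2^-1).

(* V is discrete, so f is measurable on X * V iff all its sections are. *)
Definition H_infty : set (X * V -> R) :=
  [set f | (forall g, measurable_fun setT (fun x => f (x, g))) /\
           Hnorm f < +oo].

(* Functions that agree almost everywhere are not identified: Hnorm is then a
   seminorm, with the same operator norms as on the quotient. *)
Definition op_norm (L : (X * V -> R) -> X * V -> R) : \bar R :=
  ereal_sup [set Hnorm (L f) | f in H_infty `&` [set f | Hnorm f <= 1]].

Definition spectral_radius (L : (X * V -> R) -> X * V -> R) : \bar R :=
  limn (fun k => op_norm (iter k L) `^ (k%:R^-1)).

End Extension.
End Markov.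

(* Main.v *)
Require Import Defs.
From mathcomp Require Import all_boot all_order all_algebra.
From mathcomp Require Import all_classical all_reals all_analysis.
From mathcomp Require Import measurable_realfun ess_sup_inf ring lra.

(** Let p_n(g,h) = mu(kappa^n_x g = h). The Gibbs property makes p_(m+n)
    comparable, up to a factor K, to the matrix product p_m p_n, and duality
    makes That^n comparable to the kernel p_n acting on l2(V): the essential
    supremum of That^n f in the fibre over g is at most K sum_h p_n(h,g)
    |f(.,h)|_oo, with a matching lower bound by integration when f does not
    depend on x. Hence |That^n| is, up to K, the l2 operator norm of p_n. It is
    submultiplicative up to a constant, bounded by K (p_n is doubly stochastic),
    and at least p_n(o,o); this gives R(T) <= rho <= 1. In the symmetric case,
    for R(T) < lam < 1 the Green function u(g) = sum_j lam^-j p_j(g,o) is finite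
    and positive and satisfies p_n u <= K lam^n u. Symmetry bounds the transposed
    kernel by a sum of p_k over a window around n, so the Schur test with
    weight u gives |p_n|^2 <= K^2 C_n lam^n lam^(n - N_n) / (1 - lam), whence
    rho <= lam. *)

Set Implicit Arguments.
Unset Strict Implicit.
Unset Printing Implicit Defensive.
Import Order.TTheory GRing.Theory Num.Theory.
Import numFieldNormedType.Exports.

Local Open Scope classical_set_scope.
Local Open Scope ring_scope.
Local Open Scope ereal_scope.

(** * Sums of nonnegative families over a countable type *)

(** The constants [K] are harmless because only n-th roots matter: a sequence with s(m+n) <= D s(m)
    s(n) becomes submultiplicative once multiplied by D, so Fekete's lemma still gives a limit, and
    the [limn] in the spectral radius is a genuine one. [K] itself is exp C. Distances d_r are at
    most 1, so each phi_w varies by at most this factor and is comparable to its mean mu[w]. As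
    kappa^n is constant on cylinders of rank n, the event kappa^n g = h is a union of such
    cylinders, hence independent of theta^-n B up to [K]. A different obstacle is that [transfer] is
    a real-valued sum, obtained through [fine], and functions are not identified almost everywhere.
    Its extended counterpart [etransfer] dominates it everywhere, which serves the upper bound; the
    lower bound needs equality, which is obtained only almost everywhere, by carrying null sets
    through the inverse branches. *)

Section esum_countable.
Context {R : realType}.
Implicit Types (V W : countType).

(** Transport along [pickle], with value 0 off its range, makes the theorems on series indexed by
    [nat], in particular monotone convergence, available for sums over any countable type. *)
Lemma esum_pickle V (F : V -> \bar R) : (forall v, 0 <= F v) ->
  \esum_(v in [set: V]) F v = \sum_(n <oo) oapp F 0 (pickle_inv n).
Proof.
move=> F0; have G0 n : 0 <= oapp F 0 (@pickle_inv V n) by case: pickle_inv.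
rewrite nneseries_esumT//.
rewrite (esumID (range (@pickle V)) setT)//.
rewrite [X in _ = _ + X]esum1 ?adde0; last first.
  move=> n [_ nV]; case e : pickle_inv => [v|]//=; exfalso; apply: nV.
  by exists v => //; have := @pickle_invK V n; rewrite e.
rewrite setTI esum_image; last by move=> u v _ _; exact: (pcan_inj pickleK).
by apply: eq_esum => v _; rewrite pickleK_inv.
Qed.

Lemma esum_ub V (F : V -> \bar R) v : (forall v, 0 <= F v) ->
  F v <= \esum_(v in [set: V]) F v.
Proof.
move=> F0; apply: esum_ge; exists [set v]; first by split.
by rewrite fsbig_set1.
Qed.

Lemma esumZl V (c : \bar R) (F : V -> \bar R) :
  0 <= c -> (forall v, 0 <= F v) ->
  \esum_(v in [set: V]) (c * F v) = c * \esum_(v in [set: V]) F v.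
Proof.
move=> c0 F0.
have cF0 v : 0 <= c * F v by exact: mule_ge0.
case: c c0 cF0 => [c| |] c0 cF0 //.
  rewrite !esum_pickle// -nneseriesZl; last by move=> n _; case: pickle_inv => /=.
  by apply: eq_eseriesr => n _; case: pickle_inv => //=; rewrite mule0.
(* Here c is +oo: both sides are +oo as soon as one term is positive, and 0 otherwise. *)
have [[v Fv]|noF] := pselect (exists v, 0 < F v).
  rewrite gt0_mulye; last by rewrite (lt_le_trans Fv)// esum_ub.
  apply/eqP; rewrite -leye_eq; apply: le_trans (esum_ub v cF0).
  by rewrite gt0_mulye.
have F00 v : F v = 0.
  apply/eqP; rewrite eq_le F0 andbT leNgt; apply/negP => Fv; apply: noF.
  by exists v.
by rewrite !esum1 ?mule0// => v _; rewrite F00 mule0.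
Qed.

Lemma esumZr V (c : \bar R) (F : V -> \bar R) :
  0 <= c -> (forall v, 0 <= F v) ->
  \esum_(v in [set: V]) (F v * c) = (\esum_(v in [set: V]) F v) * c.
Proof.
by move=> c0 F0; under eq_esum do rewrite muleC; rewrite esumZl// muleC.
Qed.

Lemma exchange_esum V W (F : V -> W -> \bar R) :
  (forall v w, 0 <= F v w) ->
  \esum_(v in [set: V]) \esum_(w in [set: W]) F v w =
  \esum_(w in [set: W]) \esum_(v in [set: V]) F v w.
Proof.
move=> F0; rewrite (esum_esum (J := fun=> setT))// (esum_esum (J := fun=> setT))//.
rewrite (reindex_esum ([set: W] `*`` (fun=> [set: V])) _
  (fun z : W * V => (z.2, z.1)))//.
split=> [[w v]|[w v] [w' v'] _ _ /= [-> ->]|[v w] _]//=.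
by exists (w, v).
Qed.

Lemma esum_single V (v : V) (F : V -> \bar R) : 0 <= F v ->
  (forall w, w <> v -> F w = 0) -> \esum_(w in [set: V]) F w = F v.
Proof.
move=> Fv0 Fw; rewrite (esumID [set v] setT) ?setTI; last first.
  by move=> w _; have [->//|/eqP/Fw ->] := eqVneq w v.
by rewrite esum_set1// esum1 ?adde0// => w /Fw.
Qed.

(** * Integrals of countable sums and over countable partitions *)

Section integral.
Context {d} {X : measurableType d} (mu : {measure set X -> \bar R}).

Lemma emeasurable_esum V (F : V -> X -> \bar R) :
  (forall v x, 0 <= F v x) -> (forall v, measurable_fun setT (F v)) ->
  measurable_fun setT (fun x => \esum_(v in [set: V]) F v x).
Proof.
move=> F0 mF; under eq_fun do rewrite esum_pickle//.
apply: (@ge0_emeasurable_sum _ _ _ _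
  (fun n x => oapp (F^~ x) 0 (@pickle_inv V n)) xpredT).
  by move=> n x _ _; case: pickle_inv => /=.
by move=> n _; case: pickle_inv => [v|] /=.
Qed.

Lemma integral_esum V (F : V -> X -> \bar R) :
  (forall v x, 0 <= F v x) -> (forall v, measurable_fun setT (F v)) ->
  \int[mu]_x (\esum_(v in [set: V]) F v x) =
  \esum_(v in [set: V]) \int[mu]_x F v x.
Proof.
move=> F0 mF; under eq_integral do rewrite esum_pickle//.
rewrite integral_nneseries//; last 2 first.
- by move=> n; case: pickle_inv => [v|] /=.
- by move=> n x _; case: pickle_inv => /=.
rewrite esum_pickle; last by move=> v; exact: integral_ge0.
by apply: eq_eseriesr => n _; case: pickle_inv => //=; rewrite integral0.
Qed.

Lemma integral_partition V (P : V -> set X) (f : X -> \bar R) :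
  trivIset setT P -> \bigcup_v P v = setT -> (forall v, measurable (P v)) ->
  (forall x, 0 <= f x) -> measurable_fun setT f ->
  \int[mu]_x f x = \esum_(v in [set: V]) \int[mu]_(x in P v) f x.
Proof.
move=> tP cP mP f0 mf.
have E x : f x = \esum_(v in [set: V]) (f \_ (P v)) x.
  have [v _ Pvx] : (\bigcup_v P v) x by rewrite cP.
  rewrite (@esum_single _ v); first by rewrite patchE mem_set.
    by rewrite patchE; case: ifP.
  move=> w wv; rewrite patchE memNset// => Pwx; apply: wv.
  by apply: (tP w v) => //; exists x.
rewrite (eq_integral _ _ (fun x _ => E x)) integral_esum.
- by apply: eq_esum => v _; rewrite -integral_mkcond.
- by move=> v x; rewrite patchE; case: ifP.
- move=> v; apply/(measurable_restrictT _ _).1 => //.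
  exact: measurable_funTS.
Qed.

Lemma measure_partition V (P : V -> set X) (A : set X) :
  trivIset setT P -> \bigcup_v P v = setT -> (forall v, measurable (P v)) ->
  measurable A ->
  mu A = \esum_(v in [set: V]) mu (A `&` P v).
Proof.
move=> tP cP mP mA.
rewrite -[A]setIT -integral_indic// (integral_partition tP cP mP).
- by apply: eq_esum => v _; rewrite integral_indic// setIT.
- by move=> x; rewrite lee_fin.
- exact/measurable_EFinP.
Qed.

End integral.
End esum_countable.
Ltac nonneg := intros; repeat lazymatch goal with
  | |- forall _, _ => intro
  | |- is_true (@Order.le _ _ _ (@mule _ _ _)) => apply: mule_ge0
  | |- is_true (@Order.le _ _ _ (@adde _ _ _)) => apply: adde_ge0
  | |- is_true (@Order.le _ _ _ (@esum _ _ _ _)) => apply: esum_ge0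
  | |- is_true (@Order.le _ _ _ (@expe _ _ 2)) => apply: sqre_ge0
  | |- is_true (@Order.le _ _ _ (@EFin _ _)) => rewrite lee_fin
  | |- is_true (@Order.le _ _ _ (@poweR _ _ _)) => apply: poweR_ge0
  | |- is_true (@Order.le _ _ _ (@GRing.exp _ _ 2)) => apply: sqr_ge0
  | |- _ => solve [assumption | done | apply: ltW; done | rewrite /= lee_fin; done]
  end.

(** * Nonnegative kernels on l2 *)
Section kernel_l2.
Context {R : realType} {V : countType}.
Implicit Types (q : V -> V -> \bar R) (c : R).

(** The sum runs over the first argument of [q]: mass is pushed forward from h to g. This is the
    side on which the transfer operator, dual to composition with T, acts. *)
Definition kernel_act q (a : V -> \bar R) g : \bar R :=
  \esum_(h in [set: V]) q h g * a h.

Definition sqnorm (a : V -> \bar R) : \bar R := \esum_(g in [set: V]) a g ^+ 2.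

(** [c] bounds the square of the l2 operator norm, which avoids roots. For a nonnegative kernel,
    nonnegative vectors determine this norm. *)
Definition l2_bound q c : Prop := forall a : V -> R, (forall g, (0 <= a g)%R) ->
  sqnorm (EFin \o a) < +oo ->
  sqnorm (kernel_act q (EFin \o a)) <= c%:E * sqnorm (EFin \o a).

Lemma kernel_act_ge0 q a g : (forall g h, 0 <= q g h) -> (forall g, 0 <= a g) ->
  0 <= kernel_act q a g.
Proof. by rewrite /kernel_act; nonneg. Qed.

Lemma sqnorm_ge0 a : 0 <= sqnorm a.
Proof. by rewrite /sqnorm; nonneg. Qed.

Lemma le_sqnorm a b : (forall g, 0 <= a g) -> (forall g, a g <= b g) ->
  sqnorm a <= sqnorm b.
Proof.
move=> a0 ab; apply: le_esum => g _; rewrite !expe2.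
by apply: lee_pmul => //; exact: le_trans (a0 g) (ab g).
Qed.

Lemma sqnormZ c a : sqnorm (fun g => c%:E * a g) = (c ^+ 2)%:E * sqnorm a.
Proof.
rewrite -esumZl; [|nonneg..].
by apply: eq_esum => g _; rewrite !expe2 muleACA -EFinM -expr2.
Qed.

Lemma sqnorm_ge a g : a g ^+ 2 <= sqnorm a.
Proof. by apply: (@esum_ub _ _ (fun g => a g ^+ 2)); nonneg. Qed.

Lemma sqnorm_fin_num a g : (forall g, 0 <= a g) -> sqnorm a < +oo ->
  a g \is a fin_num.
Proof.
move=> a0 a1; rewrite ge0_fin_numE//.
have := le_lt_trans (sqnorm_ge a g) a1.
by rewrite expe2; case: (a g) (a0 g) => [r| |]; rewrite ?ltry// mulyy ltxx.
Qed.

(* Cauchy-Schwarz, from [2 a_h a_k <= a_h^2 u_k / u_h + a_k^2 u_h / u_k]. *)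
Lemma esum_cauchy_schwarz (w : V -> \bar R) (a u : V -> R) :
  (forall h, 0 <= w h) -> (forall h, (0 <= a h)%R) -> (forall h, (0 < u h)%R) ->
  (\esum_(h in [set: V]) w h * (a h)%:E) ^+ 2 <=
  (\esum_(h in [set: V]) w h * (u h)%:E) *
  (\esum_(h in [set: V]) w h * (a h ^+ 2 / u h)%:E).
Proof.
move=> w0 a0 u0.
have b0 h : (0 <= a h ^+ 2 / u h)%R by rewrite divr_ge0// ?sqr_ge0// ltW.
rewrite expe2 -esumZr; [|nonneg..].
under eq_esum do (rewrite -esumZl; [|nonneg..]).
rewrite -[leRHS]esumZr; [|nonneg..].
under [leRHS]eq_esum do (rewrite -esumZl; [|nonneg..]).
set L := (leLHS); set S := (leRHS).
have S0 : 0 <= S by rewrite /S; nonneg.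
have [->|Sfin] := eqVneq S +oo; first by rewrite leey.
(* The (h, k) term of [L], taken twice, is compared with the (h, k) and (k, h) terms of [S]; halving
   requires a finite [S], hence the separate infinite case. *)
have : L + L <= S + S.
  rewrite {2}/S exchange_esum; last by nonneg.
  rewrite /L /S -!esumD; [|nonneg..].
  apply: le_esum => h _; rewrite -!esumD; [|nonneg..].
  apply: le_esum => k _; rewrite !(muleACA (w h) _ (w k)) (muleACA (w k)) (muleC (w k)) -!EFinM.
  rewrite -!ge0_muleDr; [|rewrite lee_fin mulr_ge0//; exact: ltW..].
  apply: lee_wpmul2l; first exact: mule_ge0.
  rewrite -!EFinD lee_fin.
  have := sqr_ge0 (a h * u k - a k * u h); rewrite sqrrB !exprMn => sq.
  rewrite -subr_ge0.
  have -> : (u h * (a k ^+ 2 / u k) + u k * (a h ^+ 2 / u h) -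
    (a h * a k + a h * a k) = (a h ^+ 2 * u k ^+ 2 -
    a h * u k * (a k * u h) *+ 2 + a k ^+ 2 * u h ^+ 2) / (u h * u k))%R.
    field; by rewrite !gt_eqF.
  by rewrite divr_ge0// mulr_ge0// ltW.
have Sf : S \is a fin_num by rewrite ge0_fin_numE// ltey.
case: (L) => [l| |]; rewrite ?leNye//; last first.
  by rewrite -(fineK Sf) -EFinD leye_eq.
rewrite -(fineK Sf) -!EFinD !lee_fin; lra.
Qed.

(** Cauchy-Schwarz with weight u at each g splits off the sum bounded by al; exchanging the two
    remaining sums brings out the one bounded by be. *)
Lemma schur_test q (u : V -> R) (al be : R) :
  (forall g h, 0 <= q g h) -> (forall g, (0 < u g)%R) ->
  (0 <= al)%R -> (0 <= be)%R ->
  (forall g, \esum_(h in [set: V]) q h g * (u h)%:E <= al%:E * (u g)%:E) ->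
  (forall h, \esum_(g in [set: V]) q h g * (u g)%:E <= be%:E * (u h)%:E) ->
  l2_bound q (al * be)%R.
Proof.
move=> q0 u0 al0 be0 qal qbe a a0 _.
have b0 h : (0 <= a h ^+ 2 / u h)%R by rewrite divr_ge0// ?sqr_ge0// ltW.
apply: (@le_trans _ _ (\esum_(g in [set: V]) al%:E *
   \esum_(h in [set: V]) (q h g * (u g)%:E) * (a h ^+ 2 / u h)%:E)).
  apply: le_esum => g _.
  apply: (le_trans (esum_cauchy_schwarz (q0^~ g) a0 u0)).
  apply: (@le_trans _ _ (al%:E * (u g)%:E *
      (\esum_(h in [set: V]) q h g * (a h ^+ 2 / u h)%:E))).
    by apply: lee_wpmul2r => //; nonneg.
  rewrite -muleA; apply: lee_wpmul2l; first by [].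
  rewrite -esumZl; [|nonneg..].
  by apply: le_esum => h _; rewrite muleCA muleA.
rewrite esumZl; [|nonneg..].
rewrite EFinM -muleA; apply: lee_wpmul2l; first by [].
rewrite exchange_esum; last by nonneg.
under eq_esum do (rewrite esumZr; [|nonneg..]).
rewrite /sqnorm -esumZl; [|nonneg..].
apply: le_esum => h _.
apply: (le_trans (lee_wpmul2r _ (qbe h))); first by rewrite lee_fin.
by rewrite expe2 -!EFinM lee_fin -mulrA (mulrC (u h)) divfK ?gt_eqF// expr2.
Qed.

(** Positivity turns the bound on kernels into one on their actions. The intermediate vector is
    finite by the bound on [q1], so the bound on [q2], which speaks of real vectors, applies to
    it. *)
Lemma l2_bound_comp q q1 q2 (K c1 c2 : R) :
  (forall g h, 0 <= q g h) -> (forall g h, 0 <= q1 g h) ->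
  (forall g h, 0 <= q2 g h) -> (0 <= K)%R -> (0 <= c2)%R ->
  (forall h g, q h g <= K%:E * \esum_(f in [set: V]) q1 h f * q2 f g) ->
  l2_bound q1 c1 -> l2_bound q2 c2 -> l2_bound q (K ^+ 2 * (c1 * c2))%R.
Proof.
move=> q0 q10 q20 K0 c20 qle B1 B2 a a0 afin.
have b0 g : 0 <= kernel_act q1 (EFin \o a) g.
  by apply: kernel_act_ge0 => // h; rewrite lee_fin.
have {B1}bb := B1 a a0 afin.
have bfin : sqnorm (kernel_act q1 (EFin \o a)) < +oo.
  apply: (le_lt_trans bb); move: afin.
  by rewrite -ge0_fin_numE ?sqnorm_ge0// => /fineK <-; rewrite -EFinM ltry.
pose b g := fine (kernel_act q1 (EFin \o a) g).
have bE : kernel_act q1 (EFin \o a) = EFin \o b.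
  by apply/funext => g /=; rewrite fineK// (sqnorm_fin_num _ b0).
apply: (@le_trans _ _ (sqnorm (fun g => K%:E * kernel_act q2 (EFin \o b) g))).
  apply: le_sqnorm => [g|g].
    by apply: kernel_act_ge0 => // h; rewrite lee_fin.
  rewrite -bE /kernel_act.
  under [in leRHS]eq_esum do (rewrite -esumZl; [|nonneg..]).
  rewrite exchange_esum; last by nonneg.
  rewrite -esumZl; [|nonneg..].
  apply: le_esum => h _.
  apply: (le_trans (lee_wpmul2r _ (qle h g))); first by rewrite lee_fin.
  rewrite -muleA; apply: lee_wpmul2l; first by [].
  rewrite -esumZr; [|nonneg..].
  by apply: le_esum => f _; rewrite muleA (muleC (q1 h f)).
rewrite sqnormZ (EFinM (K ^+ 2)) -muleA; apply: lee_wpmul2l; first by nonneg.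
rewrite bE in bb bfin.
have b0' g : (0 <= b g)%R by rewrite fine_ge0.
apply: (le_trans (B2 b b0' bfin)).
by rewrite (mulrC c1) EFinM -muleA; apply: lee_wpmul2l.
Qed.

(** Homogeneity; only the zero vector cannot be normalised. This fits [op_norm], a supremum over a
    unit ball. *)
Lemma l2_bound_unit_ball q c : (forall g h, 0 <= q g h) ->
  (forall a : V -> R, (forall g, (0 <= a g)%R) -> sqnorm (EFin \o a) <= 1 ->
    sqnorm (kernel_act q (EFin \o a)) <= c%:E) ->
  l2_bound q c.
Proof.
move=> q0 H a a0 afin.
have [a00|an0] := eqVneq (sqnorm (EFin \o a)) 0.
  have aE g : a g = 0%R.
    have := sqnorm_ge (EFin \o a) g; rewrite a00 expe2 /= -EFinM lee_fin => ag.
    by apply/eqP; rewrite -[_ == _]orbb -mulf_eq0 eq_le ag mulr_ge0.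
  rewrite a00 mule0 [sqnorm _]esum1// => g _; rewrite /kernel_act esum1 ?expe2 ?mule0//.
  by move=> h _ /=; rewrite aE mule0.
have af : sqnorm (EFin \o a) \is a fin_num by rewrite ge0_fin_numE ?sqnorm_ge0.
pose s := fine (sqnorm (EFin \o a)).
have s0 : (0 < s)%R by rewrite fine_gt0// lt0e an0 sqnorm_ge0 afin.
pose r := Num.sqrt s; have r0 : (0 < r)%R by rewrite sqrtr_gt0.
have rs : (r ^+ 2 = s)%R by rewrite sqr_sqrtr// ltW.
have sE : sqnorm (EFin \o a) = s%:E by rewrite fineK.
pose b g := (r^-1 * a g)%R.
have bE : EFin \o b = (fun g => (r^-1)%:E * (EFin \o a) g).
  by apply/funext => g /=.
have b1 : sqnorm (EFin \o b) = 1.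
  by rewrite bE sqnormZ sE -EFinM exprVn rs mulVf// gt_eqF.
have := H b (fun g => mulr_ge0 (ltW (etrans (invr_gt0 r) r0)) (a0 g)).
rewrite b1 => /(_ (lexx _)).
have -> : kernel_act q (EFin \o b) =
    (fun g => (r^-1)%:E * kernel_act q (EFin \o a) g).
  apply/funext => g; rewrite /kernel_act -esumZl; last 2 first.
  - by rewrite lee_fin invr_ge0 ltW.
  - by nonneg.
  by apply: eq_esum => h _; rewrite muleCA.
rewrite sqnormZ exprVn rs sE.
by rewrite -lee_pdivlMl ?invr_gt0// invrK muleC.
Qed.

(** The test vector is the unit mass at [o]. *)
Lemma l2_bound_diag q c o : (forall g h, 0 <= q g h) ->
  l2_bound q c -> q o o ^+ 2 <= c%:E.
Proof.
move=> q0 B; pose a g : R := (g == o)%:R.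
have a1 : sqnorm (EFin \o a) = 1.
  rewrite /sqnorm (@esum_single _ _ o); first by rewrite expe2 /= /a eqxx mule1.
    by nonneg.
  by move=> w /eqP/negPf wo; rewrite expe2 /= /a wo mule0.
have := B a; rewrite a1 mule1 => /(_ (fun g => ler0n _ _) (ltry 1)).
apply: le_trans; have := sqnorm_ge (kernel_act q (EFin \o a)) o.
apply: le_trans; rewrite /kernel_act (@esum_single _ _ o).
- by rewrite /= /a eqxx mule1.
- by rewrite /= /a eqxx mule1.
- by move=> w /eqP/negPf wo; rewrite /= /a wo mule0.
Qed.

End kernel_l2.

(** * Growth rates *)
Section growth_rate.
Context {R : realType}.
Implicit Types (c : R) (s : nat -> R).
Local Close Scope ereal_scope.

Lemma cvg_powR_exponent c (e : nat -> R) l : 0 < c ->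
  e n @[n --> \oo] --> l -> c `^ (e n) @[n --> \oo] --> c `^ l.
Proof.
move=> c0 el; rewrite /powR gt_eqF//.
apply: (@continuous_cvg _ _ _ _ _ (fun n => e n * ln c) expR).
  exact: continuous_expR.
by apply: cvgM => //; exact: cvg_cst.
Qed.

Lemma cvg_natV : (n%:R^-1 : R) @[n --> \oo] --> (0 : R).
Proof.
apply/gtr0_cvgV0; last exact: cvgr_idn.
by exists 1%N => // n /= n0; rewrite ltr0n.
Qed.

Lemma cvg_root c : 0 < c -> c `^ (n%:R^-1) @[n --> \oo] --> (1 : R).
Proof. by move=> c0; have := cvg_powR_exponent c0 cvg_natV; rewrite powRr0. Qed.

Lemma powR_exprK c n : 0 <= c -> (0 < n)%N -> (c ^+ n) `^ (n%:R^-1) = c.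
Proof.
move=> c0 n0; rewrite -powR_mulrn// -powRrM divff ?powRr1//.
by rewrite pnatr_eq0 -lt0n.
Qed.

Lemma root_powRK c n : 0 <= c -> (0 < n)%N -> (c `^ (n%:R^-1)) ^+ n = c.
Proof.
move=> c0 n0; rewrite -powR_mulrn ?powR_ge0// -powRrM mulVf ?powRr1//.
by rewrite pnatr_eq0 -lt0n.
Qed.

Lemma le_root (x y : R) n : 0 <= x -> x <= y -> x `^ (n%:R^-1) <= y `^ (n%:R^-1).
Proof.
by move=> x0 xy; apply: ge0_ler_powR; rewrite ?nnegrE// (le_trans x0).
Qed.

(** Euclidean division of n by m: each full block contributes a factor b^m, and [M] dominates all
    the remainders. *)
Lemma submul_geometric_bound s (b : R) m : (forall n, 0 <= s n) ->
  (forall n k, s (n + k)%N <= s n * s k) -> (0 < m)%N -> 0 < b ->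
  s m <= b ^+ m -> exists2 M, 0 < M & forall n, s n <= M * b ^+ n.
Proof.
move=> s0 sub m0 b0 sm.
(* The summand 1 only ensures that [M] is positive, so that its n-th roots tend to 1. *)
pose M := 1 + \sum_(r < m) s r / b ^+ r.
have M1 (r : 'I_m) : s r / b ^+ r <= M.
  rewrite /M (bigD1 r)//= addrCA lerDl addr_ge0// sumr_ge0// => i _.
  by rewrite divr_ge0// exprn_ge0// ltW.
exists M.
  rewrite ltr_pwDl// sumr_ge0// => i _.
  by rewrite divr_ge0// exprn_ge0// ltW.
move=> n; rewrite (divn_eq n m).
have: (n %% m < m)%N by rewrite ltn_mod.
elim: (n %/ m)%N (n %% m)%N => [|q IH] r rm.
  by rewrite mul0n add0n -ler_pdivrMr ?exprn_gt0//; exact: (M1 (Ordinal rm)).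
rewrite mulSn -addnA (le_trans (sub _ _))// exprD mulrCA.
by apply: ler_pM => //; exact: IH.
Qed.

(** The limit is the infimum of the roots. It bounds them from below; an index m whose root is
    within e/2 of it supplies a geometric rate for all n, and the constant disappears under the
    root. Index 0 is excluded because [0%:R^-1] is 0, which would make its root 1. *)
Lemma fekete_submul s : (forall n, 0 <= s n) ->
  (forall n k, s (n + k)%N <= s n * s k) ->
  exists l : R, s n `^ (n%:R^-1) @[n --> \oo] --> l.
Proof.
move=> s0 sub.
pose A := [set s m `^ (m%:R^-1) | m in [set m | (0 < m)%N]].
have A0 : has_inf A.
  split; first by exists (s 1%N `^ 1%:R^-1); exists 1%N.
  by exists 0 => _ [m _ <-]; exact: powR_ge0.
exists (inf A); apply/cvgrPdist_le => e e0.
have [_ [m /= m0 <-] sm] := inf_adherent (divr_gt0 e0 (ltr0n R 2)) A0.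
have inf0 : 0 <= inf A by apply: lb_le_inf; [exact: A0.1|move=> _ [k _ <-]; exact: powR_ge0].
pose b := inf A + e / 2.
have b0 : 0 < b by rewrite ltr_wpDl// divr_gt0.
have [|M M0 HM] := @submul_geometric_bound s b m s0 sub m0 b0.
  rewrite -(root_powRK (s0 m) m0); apply: lerXn2r; rewrite ?nnegrE ?powR_ge0//.
    exact: ltW.
  exact: ltW.
have Mb : M `^ (n%:R^-1) * b @[n --> \oo] --> 1 * b.
  by apply: cvgM; [exact: cvg_root|exact: cvg_cst].
rewrite mul1r in Mb.
have /cvgrPdist_le/(_ _ (divr_gt0 e0 (ltr0n R 2))) Mbe := Mb.
near=> n.
have n0 : (0 < n)%N by near: n; exists 1%N.
have lo : inf A <= s n `^ (n%:R^-1) by apply: ge_inf; [exact: A0.2|exists n].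
rewrite distrC ger0_norm ?subr_ge0//.
have hi : s n `^ n%:R^-1 <= M `^ n%:R^-1 * b.
  apply: (le_trans (le_root _ (s0 n) (HM n))).
  by rewrite powRM ?powR_exprK ?exprn_ge0// ltW.
have : `|b - M `^ n%:R^-1 * b| <= e / 2 by near: n.
rewrite distrC => /ler_normlW; rewrite /b in hi *; lra.
Unshelve. all: by end_near. Qed.

Lemma fekete s (D : R) : (forall n, 0 <= s n) -> 0 < D ->
  (forall n k, s (n + k)%N <= D * (s n * s k)) ->
  exists l : R, s n `^ (n%:R^-1) @[n --> \oo] --> l.
Proof.
move=> s0 D0 sub.
have [||l sl] := @fekete_submul (fun n => D * s n).
- by move=> n; rewrite mulr_ge0// ltW.
- by move=> n k; rewrite -mulrA ler_pM2l// mulrCA.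
exists (l * 1).
have -> : (fun n => s n `^ n%:R^-1) =
    (fun n => (D * s n) `^ n%:R^-1 * D^-1 `^ n%:R^-1).
  apply/funext => n; rewrite -powRM ?mulr_ge0 ?invr_ge0 ?(ltW D0)//.
  by rewrite mulrAC divff ?mul1r// gt_eqF.
have Di0 : 0 < D^-1 by rewrite invr_gt0.
apply: cvgM; [exact: sl|exact: (cvg_root Di0)].
Qed.

(** In the n-th root of the hypothesis the factors from [D] and [C] tend to 1, and lam^(n - N n)
    contributes at most lam times lam^-(N n / n), which tends to lam. So rho^2 <= lam^2. *)
Lemma symmetric_rate_le s (C : nat -> R) (N : nat -> nat) (D lam rho : R) :
  (forall n, 0 <= s n) -> (forall n, 0 <= C n) -> 0 < D -> 0 < lam < 1 ->
  (forall n, s n ^+ 2 <= D * (C n * (lam ^+ n * lam ^+ (n - N n)))) ->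
  s n `^ (n%:R^-1) @[n --> \oo] --> rho ->
  C n `^ (n%:R^-1) @[n --> \oo] --> (1 : R) ->
  (N n)%:R / n%:R @[n --> \oo] --> (0 : R) ->
  rho <= lam.
Proof.
move=> s0 C0 D0 /andP[lam0 lam1] sle srho C1 N0.
have lamV0 : 0 < lam^-1 by rewrite invr_gt0.
have Nlam := cvg_powR_exponent lamV0 N0; rewrite powRr0 in Nlam.
have rhs : D `^ n%:R^-1 * (C n `^ n%:R^-1 * (lam * (lam *
    lam^-1 `^ ((N n)%:R / n%:R)))) @[n --> \oo] --> 1 * (1 * (lam * (lam * 1))).
  apply: cvgM; first exact: cvg_root.
  apply: cvgM; first exact: C1.
  apply: cvgM; first exact: cvg_cst.
  by apply: cvgM; [exact: cvg_cst|exact: Nlam].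
have lhs : s n `^ n%:R^-1 * s n `^ n%:R^-1 @[n --> \oo] --> rho * rho.
  by apply: cvgM.
have rho0 : 0 <= rho.
  by apply: (ler_cvg_to (cvg_cst 0) srho); near=> n; exact: powR_ge0.
have : rho * rho <= 1 * (1 * (lam * (lam * 1))).
  apply: (ler_cvg_to lhs rhs); near=> n.
  have n0 : (0 < n)%N by near: n; exists 1%N.
  rewrite -powRM// -expr2.
  apply: (le_trans (le_root _ (sqr_ge0 _) (sle n))).
  have l0 k : 0 <= lam ^+ k by rewrite exprn_ge0// ltW.
  rewrite !powRM ?mulr_ge0// ?(ltW D0)//.
  rewrite powR_exprK ?(ltW lam0)//.
  do 3!(apply: ler_wpM2l; rewrite ?powR_ge0 ?(ltW lam0)//).
  rewrite powRrM powR_mulrn ?(ltW lamV0)// -[X in X * _](powR_exprK (ltW lam0) n0).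
  rewrite -powRM ?l0// ?exprn_ge0 ?(ltW lamV0)//.
  (* What remains is lam^(n - N n) <= lam^n lam^-(N n). With truncated subtraction, (n - N n) + N n
     is max(n, N n), hence at least n. *)
  apply: le_root => //; rewrite exprVn ler_pdivlMr ?exprn_gt0// -exprD.
  by apply: ler_wiXn2l; rewrite ?(ltW lam0) ?(ltW lam1)// addnC -maxnE leq_maxr.
rewrite !mul1r mulr1 -!expr2 ler_pXn2r ?nnegrE//.
exact: ltW.
Unshelve. all: by end_near. Qed.

End growth_rate.

(** * Supermultiplicative families of kernels *)
Section walk.
Context {R : realType} {V : countType} (p : nat -> V -> V -> \bar R).
Context (K : R) (o : V).
Hypothesis p0 : forall n g h, 0 <= p n g h.
Hypothesis p1 : forall n g h, p n g h <= 1.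
Hypothesis K0 : (0 < K)%R.
Hypothesis p_super : forall m n g h,
  \esum_(f in [set: V]) p m g f * p n f h <= K%:E * p (m + n) g h.
Hypothesis p_trans : forall g h, exists k, 0 < p k g h.

(** * The Green function as an almost superharmonic weight *)

Section green.
Context (lam : R).
Hypothesis lam0 : (0 < lam)%R.

Let lamV n : (0 <= lam ^- n)%R. Proof. by rewrite invr_ge0 exprn_ge0// ltW. Qed.

Definition green g : \bar R :=
  \esum_(j in [set: nat]) (lam ^- j)%:E * p j g o.

Lemma green_ge0 g : 0 <= green g.
Proof. by rewrite /green; nonneg. Qed.

Lemma esum_shift (F : nat -> \bar R) m : (forall n, 0 <= F n) ->
  \esum_(j in [set: nat]) F (m + j)%N <= \esum_(j in [set: nat]) F j.
Proof.
move=> F0; rewrite -(esum_image setT (addn m) F); last first.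
  by move=> i j _ _ /addnI.
rewrite esum_mkcond; apply: le_esum => i _; by case: ifP.
Qed.

Lemma green_shift m g :
  \esum_(j in [set: nat]) (lam ^- j)%:E * p (m + j) g o <=
  (lam ^+ m)%:E * green g.
Proof.
apply: (@le_trans _ _ ((lam ^+ m)%:E *
    \esum_(j in [set: nat]) (lam ^- (m + j))%:E * p (m + j) g o)).
  rewrite -esumZl; [|by rewrite lee_fin exprn_ge0// ltW|nonneg].
  apply: le_esum => j _; rewrite muleA -EFinM exprD invfM mulrA divff ?mul1r//.
  by rewrite expf_neq0// gt_eqF.
apply: lee_wpmul2l; first by rewrite lee_fin exprn_ge0// ltW.
by apply: (@esum_shift (fun j => (lam ^- j)%:E * p j g o)); nonneg.
Qed.

(** Applied termwise, supermultiplicativity replaces p_m p_j by K p_(m+j); the shift of the index j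
    by m costs lam^m and drops the first m terms. *)
Lemma green_super m g :
  \esum_(f in [set: V]) p m g f * green f <=
  K%:E * ((lam ^+ m)%:E * green g).
Proof.
apply: le_trans (lee_wpmul2l (ltW (K0 : 0 < K%:E)) (green_shift m g)).
rewrite -esumZl; [|nonneg..].
under eq_esum do (rewrite -esumZl; [|nonneg..]).
rewrite exchange_esum; last by nonneg.
apply: le_esum => j _; rewrite muleCA.
under eq_esum do rewrite muleCA.
rewrite esumZl; [|nonneg..].
by apply: lee_wpmul2l => //; rewrite lee_fin.
Qed.

Lemma green_gt0 g : 0 < green g.
Proof.
have [k pk] := p_trans g o.
apply: (@lt_le_trans _ _ ((lam ^- k)%:E * p k g o)).
  by rewrite mule_gt0// lte_fin invr_gt0 exprn_gt0.
by apply: (@esum_ub _ _ (fun k => (lam ^- k)%:E * p k g o)); nonneg.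
Qed.

(** A Harnack inequality: p_k(o,g) green(g) <= K lam^k green(o), where k is chosen by transitivity
    so that p_k(o,g) > 0. *)
Lemma green_fin_num g : green o < +oo -> green g \is a fin_num.
Proof.
move=> go; rewrite ge0_fin_numE ?green_ge0//.
have [k pk] := p_trans o g.
have : p k o g * green g <= K%:E * ((lam ^+ k)%:E * green o).
  apply: le_trans (green_super k o).
  apply: (@esum_ub _ _ (fun f => p k o f * green f)) => f.
  by rewrite mule_ge0// green_ge0.
have gof : green o \is a fin_num by rewrite ge0_fin_numE// green_ge0.
rewrite -(fineK gof) -!EFinM; case: (green g) (green_ge0 g) => [r| |]//.
  by rewrite ltry.
by rewrite gt0_muley// leye_eq.
Qed.

End green.

Lemma geometric_sum_le (r : R) m n : (0 < r < 1)%R ->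
  (\sum_(m <= k < n) r ^+ k <= r ^+ m / (1 - r))%R.
Proof.
move=> /andP[r0 r1]; have [nm|mn] := leqP n m.
  by rewrite big_geq// divr_ge0 ?exprn_ge0 ?subr_ge0 ?ltW.
rewrite -(subnKC (ltnW mn)) geometric_partial_tail.
by apply: geometric_le_lim; rewrite ?exprn_ge0 ?gtr0_norm// ltW.
Qed.

Lemma esum_geometric_le (r : R) : (0 < r < 1)%R ->
  \esum_(j in [set: nat]) (r ^+ j)%:E <= ((1 - r)^-1)%:E.
Proof.
move=> r01; have r0 j : 0 <= (r ^+ j)%:E.
  by case/andP: r01 => r0 _; rewrite lee_fin exprn_ge0// ltW.
rewrite -nneseries_esumT//; apply: lime_le; first exact: is_cvg_nneseries.
apply: nearW => n; rewrite sumEFin lee_fin (le_trans (geometric_sum_le _ _ r01))//.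
by rewrite expr0 mul1r.
Qed.

(** [limn_esup] is an infimum of suprema over eventual sets, so some tail of the roots has supremum
    S < lam; comparison with a geometric series follows. Positivity of lam comes from S >= 0. *)
Lemma root_test_green lam : (lam < 1)%R ->
  limn_esup (fun n => p n o o `^ (n%:R^-1)) < lam%:E ->
  (0 < lam)%R /\ green lam o < +oo.
Proof.
move=> lam1 /ereal_inf_lt[_ [A [N _ NA] <-]].
set S := ereal_sup _ => Slam.
have S_ge n : (N <= n)%N -> p n o o `^ n%:R^-1 <= S.
  by move=> Nn; apply: ereal_sup_ubound; exists n => //; exact: NA.
have S0 : 0 <= S by rewrite (le_trans _ (S_ge N _))// poweR_ge0.
have Sf : S \is a fin_num by rewrite ge0_fin_numE// (lt_trans Slam)// ltry.
have [s0 slam] : (0 <= fine S)%R /\ (fine S < lam)%R.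
  by rewrite fine_ge0// -lte_fin fineK.
(* The midpoint is positive even when S is 0. *)
pose b := ((fine S + lam) / 2)%R.
have [b0 blam] : (0 < b)%R /\ (b < lam)%R by rewrite /b; split; lra.
have lam0 : (0 < lam)%R by lra.
have b1 : (b < 1)%R by lra.
split=> //.
(* The factor b^-N takes care of the indices up to N, where only p <= 1 is known. *)
have pb n : p n o o <= (b ^- N * b ^+ n)%:E.
  have [nN|Nn] := leqP n N.
    apply: (le_trans (p1 n o o)).
    rewrite lee_fin mulrC ler_pdivlMr ?exprn_gt0// mul1r.
    by rewrite ler_wiXn2l// ltW.
  have n0 : (0 < n)%N by apply: leq_trans Nn.
  apply: (@le_trans _ _ (b ^+ n)%:E); last first.
    rewrite lee_fin ler_peMl ?exprn_ge0 ?(ltW b0)//.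
    by rewrite invf_ge1 ?exprn_gt0// exprn_ile1// ltW.
  have pf : p n o o \is a fin_num.
    by rewrite ge0_fin_numE// (le_lt_trans (p1 n o o))// ltry.
  have := S_ge n (ltnW Nn).
  rewrite -(fineK pf) -(fineK Sf) poweR_EFin !lee_fin => H.
  rewrite -(root_powRK (fine_ge0 (p0 n o o)) n0).
  apply: lerXn2r; rewrite ?nnegrE ?powR_ge0// ?(ltW b0)//.
  by rewrite (le_trans H)// /b; lra.
pose r := (b / lam)%R.
have r01 : (0 < r < 1)%R by rewrite divr_gt0//= ltr_pdivrMr// mul1r.
have r0 : (0 <= r)%R by rewrite divr_ge0// ltW.
apply: (@le_lt_trans _ _ ((b ^- N)%:E * \esum_(j in [set: nat]) (r ^+ j)%:E)).
  rewrite -esumZl; last 2 first.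
  - by rewrite lee_fin invr_ge0 exprn_ge0// ltW.
  - by move=> j; rewrite lee_fin exprn_ge0.
  apply: le_esum => j _; apply: (le_trans (lee_wpmul2l _ (pb j))).
    by rewrite lee_fin invr_ge0 exprn_ge0// ltW.
  by rewrite -!EFinM lee_fin mulrCA (expr_div_n b) (mulrC (lam ^- j)).
apply: (@le_lt_trans _ _ ((b ^- N)%:E * ((1 - r)^-1)%:E)).
  apply: lee_wpmul2l; first by rewrite lee_fin invr_ge0 exprn_ge0// ltW.
  exact: esum_geometric_le.
by rewrite -EFinM ltry.
Qed.

(* Schur test with the Green function as weight: supermultiplicativity bounds
   the row sums directly, and the column sums through the symmetry bound. *)
Lemma symmetric_l2_bound lam (C : nat -> R) (N : nat -> nat) n :
  (0 < lam < 1)%R -> green lam o < +oo -> (0 <= C n)%R ->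
  (forall v w, p n v w <=
    (C n)%:E * \sum_(n - N n <= k < (n + N n).+1) p k w v) ->
  l2_bound (p n)
    (K ^+ 2 / (1 - lam) * (C n * (lam ^+ n * lam ^+ (n - N n))))%R.
Proof.
move=> lam01 go C0 sym; have /andP[lam0 lam1] := lam01.
have K0' := ltW K0.
have gf g : green lam g \is a fin_num by exact: green_fin_num.
have g0 g : (0 < fine (green lam g))%R.
  by rewrite fine_gt0// green_gt0//= -ge0_fin_numE// ltW// green_gt0.
have l0 k : (0 <= lam ^+ k)%R by rewrite exprn_ge0// ltW.
have d0 : (0 <= (1 - lam)^-1)%R by rewrite invr_ge0 subr_ge0 ltW.
(* The constant is split into the bound for sums over the first argument, obtained from symmetry,
   and the bound for sums over the second. *)
have -> : (K ^+ 2 / (1 - lam) * (C n * (lam ^+ n * lam ^+ (n - N n))) =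
   (C n * (K * (lam ^+ (n - N n) / (1 - lam)))) * (K * lam ^+ n))%R.
  by rewrite expr2; ring.
apply: (@schur_test _ _ _ (fun g => fine (green lam g))) => //.
- by rewrite !mulr_ge0.
- by rewrite !mulr_ge0.
- move=> g; under eq_esum do rewrite fineK//.
  rewrite fineK// EFinM -muleA.
  apply: (@le_trans _ _ ((C n)%:E * \esum_(h in [set: V])
      (\sum_(n - N n <= k < (n + N n).+1) p k g h) * green lam h)).
    rewrite -esumZl//; last by move=> h; rewrite mule_ge0 ?green_ge0// sume_ge0.
    apply: le_esum => h _; rewrite muleA.
    by apply: lee_wpmul2r; [exact: green_ge0|exact: sym].
  apply: lee_wpmul2l; first by rewrite lee_fin.
  under eq_esum do (rewrite ge0_sume_distrl; [|by []]).
  rewrite esum_sum; last by move=> *; rewrite mule_ge0 ?green_ge0.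
  apply: (@le_trans _ _ (\sum_(n - N n <= k < (n + N n).+1)
      K%:E * ((lam ^+ k)%:E * green lam g))).
    by apply: lee_sum => k _; exact: green_super.
  rewrite -ge0_sume_distrr; last first.
    by move=> k _; rewrite mule_ge0 ?green_ge0// lee_fin.
  rewrite EFinM -muleA; apply: lee_wpmul2l; first by rewrite lee_fin.
  rewrite -ge0_sume_distrl; last by move=> k _; rewrite lee_fin.
  apply: lee_wpmul2r; first exact: green_ge0.
  by rewrite sumEFin lee_fin geometric_sum_le.
- move=> h; under eq_esum do rewrite fineK//.
  by rewrite fineK// EFinM -muleA green_super.
Qed.

End walk.

(** * Cylinders of a full-branch Gibbs-Markov map *)
Section cylinders.
Context {R : realType} {d} {X : measurableType d} (mu : probability X R).
Context {I : countType} (cell : I -> set X) (theta : X -> X).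
Hypothesis mm : markov_map mu cell theta.
Hypothesis full : full_branches mu cell theta.
Local Notation cyl := (cyl cell theta).
Local Notation tau := (tau cell theta).

Let mcell := cell_measurable mm.
Let mimage i : measurable (theta @` cell i).
Proof. exact: (theta_image_measurable mm (mcell i) (fun _ => id)). Qed.

Lemma measurable_cell_preimage i (B : set X) : measurable B ->
  measurable (cell i `&` theta @^-1` B).
Proof. by move=> mB; exact: (theta_measurable mm (mcell i) mB). Qed.

Lemma measurable_cyl w : measurable (cyl w).
Proof. by elim: w => //= i w IH; exact: measurable_cell_preimage. Qed.

Lemma measurable_theta : measurable_fun setT theta.
Proof.
move=> _ B mB; rewrite setTI -[theta @^-1` B]setTI -(cell_cover mm) setI_bigcupl.
by apply: countable_bigcupT_measurable => // i; exact: measurable_cell_preimage.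
Qed.

Lemma measurable_iter_theta n : measurable_fun setT (iter n theta).
Proof.
elim: n => [|n IH]; first exact: measurable_id.
exact: measurableT_comp measurable_theta IH.
Qed.

Lemma measurable_iter_preimage n (B : set X) : measurable B ->
  measurable (iter n theta @^-1` B).
Proof. by move=> mB; rewrite -[_ @^-1` _]setTI; exact: measurable_iter_theta. Qed.

Lemma iter_theta_inj w : {in cyl w &, injective (iter (size w) theta)}.
Proof.
elim: w => [|i w IH] x y //=; rewrite !inE => -[ix wx] [iy wy].
rewrite -!iterS !iterSr => /IH; rewrite !inE => /(_ wx wy) xy.
by apply: (theta_inj mm (a := i)) xy; rewrite inE.
Qed.

Lemma iter_image_measurable w (B : set X) : measurable B -> B `<=` cyl w ->
  measurable (iter (size w) theta @` B).
Proof.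
elim: w B => [|i w IH] B mB Bw /=; first by rewrite image_id.
have -> : iter (size w).+1 theta @` B = iter (size w) theta @` (theta @` B).
  by rewrite image_comp; apply: eq_imagel => x _; rewrite iterSr.
apply: IH; first by apply: (theta_image_measurable mm (a := i) mB) => x /Bw[].
by move=> _ [x /Bw[_ wx] <-].
Qed.

Lemma iter_nonsingular w (B : set X) : measurable B -> B `<=` cyl w ->
  mu B = 0 <-> mu (iter (size w) theta @` B) = 0.
Proof.
elim: w B => [|i w IH] B mB Bw /=; first by rewrite image_id.
have -> : iter (size w).+1 theta @` B = iter (size w) theta @` (theta @` B).
  by rewrite image_comp; apply: eq_imagel => x _; rewrite iterSr.
have Bi : B `<=` cell i by move=> x /Bw[].
apply: (iff_trans (theta_nonsingular mm mB Bi)); apply: IH.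
  exact: (theta_image_measurable mm mB Bi).
by move=> _ [x /Bw[_ wx] <-].
Qed.

(** A point of theta^n[w] missed by the longer word i w comes from a point of [w] outside theta(cell
    i). Full branches make the set of such points null, and nonsingularity keeps its image null. *)
Lemma iter_image_full w : mu (~` (iter (size w) theta @` cyl w)) = 0.
Proof.
elim: w => [|i w IH]; first by rewrite image_id setCT measure0.
have mD : measurable (cyl w `\` theta @` cell i).
  by apply: measurableD; [exact: measurable_cyl|exact: mimage].
have mE : measurable (iter (size w) theta @` (cyl w `\` theta @` cell i)).
  by apply: iter_image_measurable => // x [].
have mF v : measurable (iter (size v) theta @` cyl v).
  by apply: iter_image_measurable => //; exact: measurable_cyl.
have E0 : mu (iter (size w) theta @` (cyl w `\` theta @` cell i)) = 0.
  apply: (proj1 (iter_nonsingular mD _)); first by move=> x [].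
  apply: (subset_measure0 mD (measurableC (mimage i)) _ (full i)).
  by move=> x [].
have mCw : measurable (~` (iter (size w) theta @` cyl w)) by exact: measurableC.
apply: (subset_measure0 _ (measurableU _ _ mCw mE)).
- by apply: measurableC; exact: (mF (i :: w)).
- move=> y /= ny; have [[x wx xy]|] := pselect ((iter (size w) theta @` cyl w) y).
    right; exists x => //; split=> // -[z iz zx]; apply: ny; exists z.
      by split=> //=; rewrite zx.
    by rewrite -iterS iterSr zx.
  by left.
- exact: etrans (measureU0 mCw mE E0) IH.
Qed.

(** By nonsingularity a null cylinder would have a null image, whereas that image has full
    measure. *)
Lemma cyl_gt0 w : 0 < mu (cyl w).
Proof.
rewrite lt0e measure_ge0 andbT; apply/eqP.
move=> /(proj1 (iter_nonsingular (measurable_cyl w) (fun _ => id))) w0.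
have := iter_image_full w; rewrite probability_setC.
  by rewrite w0 sube0 => /eqP; rewrite onee_eq0.
by apply: iter_image_measurable => //; exact: measurable_cyl.
Qed.

Lemma full_admissible w : w != [::] -> admissible mu cell theta w.
Proof.
rewrite /admissible.
have E a b : `[< mu (cell b `\` theta @` cell a) = 0 >].
  apply/asboolP.
  apply: (subset_measure0 (measurableD (mcell b) (mimage a))
    (measurableC (mimage a)) _ (full a)).
  by move=> x [].
case: w => [/eqP//|a w _ /=].
by elim: w a => [//|b w IH a /=]; rewrite E IH.
Qed.

Lemma cyl_inj u v x : cyl u x -> cyl v x -> size u = size v -> u = v.
Proof.
elim: u v x => [|i u IH] [|j v] x //= [ix ux] [jx vx] [s].
congr cons; last exact: IH ux vx s.
by apply: (cell_disjoint mm) => //; exists x.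
Qed.

Lemma cyl_trivIset n : trivIset setT (fun w : n.-tuple I => cyl w).
Proof.
move=> u v _ _ [x [ux vx]]; apply: val_inj.
by apply: (cyl_inj ux vx); rewrite !size_tuple.
Qed.

Lemma cyl_cover n : \bigcup_(w : n.-tuple I) cyl w = setT.
Proof.
rewrite -subTset => x _.
suff [w sw wx] : exists2 w, size w = n & cyl w x.
  by exists (tcast sw (in_tuple w)); rewrite ?val_tcast.
elim: n x => [|n IH] x; first by exists [::].
have [i _ ix] : (\bigcup_a cell a) x by rewrite (cell_cover mm).
by have [w sw wx] := IH (theta x); exists (i :: w); rewrite /= ?sw.
Qed.

Lemma tauK w x : cyl w x -> tau w (iter (size w) theta x) = x.
Proof. by move=> wx; rewrite /tau pinvKV ?inE//; exact: iter_theta_inj. Qed.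

Lemma tau_image w (B : set X) :
  tau w @` (B `&` iter (size w) theta @` cyl w) =
  cyl w `&` iter (size w) theta @^-1` B.
Proof.
apply/seteqP; split=> [_ [z [Bz [x wx zx]] <-]|x [wx Bx]].
  by rewrite -zx tauK//; split=> //=; rewrite zx.
by exists (iter (size w) theta x); [split=> //; exists x|rewrite tauK].
Qed.

End cylinders.

(** * Gibbs distortion *)
Section weighted_integral.
Context {R : realType} {d} {X : measurableType d} (mu : {measure set X -> \bar R}).
Import HBNNSimple.

Let weighted_nnsfun (f : X -> \bar R) (t : X -> X) (h : {nnsfun X >-> R}) :
  (forall x, 0 <= f x) -> measurable_fun setT f -> measurable_fun setT t ->
  \int[mu]_x (f x * (h (t x))%:E) =
  \sum_(y \in range h) y%:E *
    \int[mu]_x (f x * (\1_(h @^-1` [set y]) (t x))%:E).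
Proof.
move=> f0 mf mt.
transitivity (\int[mu]_x (\sum_(y \in range h)
    y%:E * (f x * (\1_(h @^-1` [set y]) (t x))%:E))).
  apply: eq_integral => x _; rewrite (fimfunE h (t x)) -fsumEFin//.
  rewrite muleC ge0_mule_fsuml; last by move=> y; exact: nnfun_muleindic_ge0.
  by apply: eq_fsbigr => y _; rewrite EFinM -muleA (muleC _ (f x)).
have m1 y : measurable_fun setT (fun x => f x * (\1_(h @^-1` [set y]) (t x))%:E).
  by apply: emeasurable_funM => //; apply/measurable_EFinP; exact: measurableT_comp.
rewrite ge0_integral_fsum//.
- apply: eq_fsbigr => y; rewrite inE => -[x _ <-].
  rewrite ge0_integralZl//; first by move=> ? _; rewrite mule_ge0// lee_fin.
  by rewrite lee_fin.
- by move=> y; exact: measurable_funeM.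
- move=> y x _; rewrite muleCA mule_ge0//.
  exact: (@nnfun_muleindic_ge0 _ _ _ h).
Qed.

(** From indicators to simple functions to monotone limits. It serves to identify the measure phi_i
    dmu with the image under theta of mu restricted to cell i. *)
Lemma eq_weighted_integral (f1 f2 : X -> R) (t1 t2 : X -> X) (G : X -> \bar R) :
  (forall x, (0 <= f1 x)%R) -> (forall x, (0 <= f2 x)%R) ->
  measurable_fun setT f1 -> measurable_fun setT f2 ->
  measurable_fun setT t1 -> measurable_fun setT t2 ->
  (forall B, measurable B -> \int[mu]_x ((f1 x)%:E * (\1_B (t1 x))%:E) =
                             \int[mu]_x ((f2 x)%:E * (\1_B (t2 x))%:E)) ->
  (forall x, 0 <= G x) -> measurable_fun setT G ->
  \int[mu]_x ((f1 x)%:E * G (t1 x)) = \int[mu]_x ((f2 x)%:E * G (t2 x)).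
Proof.
move=> f10 f20 mf1 mf2 mt1 mt2 f12 G0 mG.
pose h := nnsfun_approx measurableT mG.
have lim_h (f : X -> R) t : (forall x, (0 <= f x)%R) -> measurable_fun setT f ->
    measurable_fun setT t -> \int[mu]_x ((f x)%:E * G (t x)) =
    limn (fun n => \sum_(y \in range (h n)) y%:E *
      \int[mu]_x ((f x)%:E * (\1_(h n @^-1` [set y]) (t x))%:E)).
  move=> f0 mf mt; have mEf : measurable_fun setT (EFin \o f) by exact/measurable_EFinP.
  transitivity (limn (fun n => \int[mu]_x ((f x)%:E * (h n (t x))%:E))); last first.
    by congr (limn _); apply/funext => n; rewrite (weighted_nnsfun (f := EFin \o f)).
  rewrite -monotone_convergence//.
  - apply: eq_integral => x _; apply/esym/cvg_lim => //.
    by apply: cvgeZl => //; exact: cvg_nnsfun_approx.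
  - move=> n; apply: emeasurable_funM => //.
    by apply/measurable_EFinP; exact: measurableT_comp.
  - by move=> n x _; rewrite mule_ge0// lee_fin.
  - move=> x _ m n mn; apply: lee_wpmul2l; rewrite lee_fin//.
    exact/lefP/nd_nnsfun_approx.
rewrite !lim_h//; congr (limn _); apply/funext => n.
by apply: eq_fsbigr => y _; rewrite f12.
Qed.

End weighted_integral.

(** * Bounded distortion of the Jacobians and decoupling of cylinders *)

Section gibbs.
Context {R : realType} {d} {X : measurableType d} (mu : probability X R).
Context {I : countType} (cell : I -> set X) (theta : X -> X).
Context (phi : seq I -> X -> R).
Hypothesis gm : gibbs_markov_full mu cell theta phi.
Local Notation cyl := (cyl cell theta).
Local Notation tau := (tau cell theta).

Let mm := gm_markov gm.
Let full := gm_full gm.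

Lemma jacobian_word w : w != [::] -> is_jacobian mu cell theta w (phi w).
Proof. by move=> w0; apply: (gm_jacobian gm); exact: (full_admissible mm full). Qed.

Lemma phi_ge0 w x : w != [::] -> (0 <= phi w x)%R.
Proof. by move=> /jacobian_word[]. Qed.

Lemma measurable_phi w : w != [::] -> measurable_fun setT (phi w).
Proof. by move=> /jacobian_word[]. Qed.

(** The Jacobian property only concerns subsets of theta^n[w]; the complement of that image is null,
    so any measurable B is allowed. *)
Lemma integral_phi w (B : set X) : w != [::] -> measurable B ->
  \int[mu]_(x in B) (phi w x)%:E = mu (cyl w `&` iter (size w) theta @^-1` B).
Proof.
move=> w0 mB; have [mphi phi0 jac] := jacobian_word w0.
have mD : measurable (iter (size w) theta @` cyl w).
  by apply: (iter_image_measurable mm) => //; exact: (measurable_cyl mm).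
rewrite (ge0_negligible_integral (measurableC mD) mB _ _
  (iter_image_full mm full w))//; last first.
- by move=> x _; rewrite lee_fin.
- by apply: measurable_funTS; exact/measurable_EFinP.
rewrite setDE setCK -jac//; last exact: measurableI.
by rewrite (tau_image mm).
Qed.

(** The part of [w] that theta^n sends into the zero set of phi_w has measure 0, being an integral
    of zero; by nonsingularity its image is null too. Positivity is what allows ratios to be
    recovered from differences of [ln]. *)
Lemma phi_gt0_ae w : w != [::] -> \forall x \ae mu, (0 < phi w x)%R.
Proof.
move=> w0; have mphi := measurable_phi w0.
pose A := phi w @^-1` [set 0%R].
have mA : measurable A by rewrite -[A]setTI; exact: mphi.
have mD : measurable (iter (size w) theta @` cyl w).
  by apply: (iter_image_measurable mm) => //; exact: (measurable_cyl mm).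
have mP : measurable (cyl w `&` iter (size w) theta @^-1` A).
  apply: measurableI; first exact: (measurable_cyl mm).
  exact: (measurable_iter_preimage mm).
have : mu (cyl w `&` iter (size w) theta @^-1` A) = 0.
  rewrite -integral_phi//; apply: integral0_eq => x.
  by rewrite /A /= => ->.
move=> /(proj1 (iter_nonsingular mm mP (@subIsetl _ _ _))) mu0.
have mI : measurable (iter (size w) theta @` (cyl w `&` iter (size w) theta @^-1` A)).
  by apply: (iter_image_measurable mm) => // x [].
exists (~` (iter (size w) theta @` cyl w) `|`
  iter (size w) theta @` (cyl w `&` iter (size w) theta @^-1` A)); split.
- by apply: measurableU => //; exact: measurableC.
- apply: etrans (iter_image_full mm full w).
  by rewrite measureU0//; exact: measurableC.
- move=> x /= /negP; rewrite lt_neqAle phi_ge0// andbT negbK => /eqP px.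
  have [[z wz zx]|] := pselect ((iter (size w) theta @` cyl w) x); last by left.
  by right; exists z => //; split=> //=; rewrite /A /= zx.
Qed.

Lemma d_itin_le1 (r : R) x y : (0 < r < 1)%R -> (d_itin cell theta r x y <= 1)%R.
Proof.
move=> /andP[r0 r1]; rewrite /d_itin; case: pselect => // h.
by rewrite exprn_ile1// ltW.
Qed.

Lemma phi_oscillation : exists2 K : R, (1 <= K)%R & forall w, w != [::] ->
  \forall x \ae mu, \forall y \ae mu,
    (phi w x <= K * phi w y)%R /\ (phi w y <= K * phi w x)%R.
Proof.
have [C [r [C0 r01 H]]] := gm_gibbs gm.
exists (expR C); first by rewrite -expR0 ler_expR ltW.
move=> w w0; have pos := phi_gt0_ae w0.
have {H}H := H w (full_admissible mm full w0).
near=> x; near=> y.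
have px : (0 < phi w x)%R by near: x.
have py : (0 < phi w y)%R by near: y.
have : (`|ln (phi w x) - ln (phi w y)| <= C * d_itin cell theta r x y)%R.
  near: y; near: x; exact: H.
move=> /le_trans; have /[swap]/[apply] : (C * d_itin cell theta r x y <= C)%R.
  by rewrite ler_piMr ?d_itin_le1// ltW.
rewrite ler_norml => /andP[lo hi].
rewrite -(lnK px) -(lnK py) -!expRD !ler_expR; split; lra.
Unshelve. all: by end_near. Qed.

Section distortion.
Context (K : R).
Hypothesis K1 : (1 <= K)%R.
Hypothesis osc : forall w, w != [::] -> \forall x \ae mu, \forall y \ae mu,
  (phi w x <= K * phi w y)%R /\ (phi w y <= K * phi w x)%R.

Let K0 : (0 <= K)%R. Proof. exact: le_trans ler01 K1. Qed.

Lemma integral_phi_cyl w : w != [::] ->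
  \int[mu]_x (phi w x)%:E = mu (cyl w).
Proof. by move=> w0; rewrite integral_phi// preimage_setT setIT. Qed.

(** With x fixed, the oscillation bound is integrated over y: the mean of phi_w is mu[w]. *)
Lemma phi_ae_bounds w : w != [::] -> \forall x \ae mu,
  (phi w x)%:E <= K%:E * mu (cyl w) /\ mu (cyl w) <= K%:E * (phi w x)%:E.
Proof.
move=> w0; have phi0 x := phi_ge0 x w0.
have mphi : measurable_fun setT (EFin \o phi w).
  exact/measurable_EFinP/measurable_phi.
have ocst (c : R) : c%:E = \int[mu]_x (cst c%:E x).
  by rewrite integral_cst// (_ : _ setT = 1) ?mule1//; exact: probability_setT.
near=> x; have Hx : \forall y \ae mu,
  (phi w x <= K * phi w y)%R /\ (phi w y <= K * phi w x)%R.
  by near: x; exact: osc.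
rewrite -(integral_phi_cyl w0); split.
  rewrite [leLHS]ocst -ge0_integralZl//; [|by move=> y _; rewrite lee_fin..].
  apply: ae_ge0_le_integral => //.
  - by move=> y _; rewrite lee_fin.
  - by move=> y _; rewrite mule_ge0// lee_fin.
  - exact: measurable_funeM.
  - by apply: filterS Hx => y [h _] _; rewrite -EFinM lee_fin.
rewrite -EFinM [leRHS]ocst.
apply: ae_ge0_le_integral => //.
- by move=> y _; rewrite lee_fin.
- by move=> y _; rewrite lee_fin mulr_ge0.
- by apply: filterS Hx => y [_ h] _; rewrite lee_fin.
Unshelve. all: by end_near. Qed.

(** The almost sure bounds on phi_w are integrated over B. The empty word, for which no Jacobian is
    available, only needs K >= 1. *)
Lemma cyl_distortion w (B : set X) : measurable B ->
  mu (cyl w `&` iter (size w) theta @^-1` B) <= K%:E * (mu (cyl w) * mu B) /\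
  mu (cyl w) * mu B <= K%:E * mu (cyl w `&` iter (size w) theta @^-1` B).
Proof.
move=> mB; have [->|w0] := eqVneq w [::].
  rewrite /= setTI probability_setT mul1e.
  have : mu B <= K%:E * mu B by rewrite -[leLHS]mul1e lee_wpmul2r// lee_fin.
  by [].
have phi0 x := phi_ge0 x w0.
have mphi : measurable_fun setT (EFin \o phi w).
  exact/measurable_EFinP/measurable_phi.
have bounds := phi_ae_bounds w0.
have cstB (c : \bar R) : \int[mu]_(x in B) (cst c x) = c * mu B.
  by rewrite integral_cst.
rewrite -integral_phi//; split.
  rewrite muleA -cstB; apply: ae_ge0_le_integral => //.
  - by move=> y _; rewrite lee_fin.
  - exact: measurable_funTS.
  - by move=> y _; rewrite mule_ge0// lee_fin.
  - by apply: filterS bounds => y [h _] _.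
have mphiB : measurable_fun B (EFin \o phi w) by exact: measurable_funTS.
have phiB x : B x -> 0 <= (phi w x)%:E by rewrite lee_fin.
rewrite -ge0_integralZl ?lee_fin// -cstB; apply: ae_ge0_le_integral => //.
- by move=> y _; rewrite mule_ge0// lee_fin.
- by apply: measurable_funeM; exact: measurable_funTS.
- by apply: filterS bounds => y [_ h] _.
Qed.

(** E is a union of cylinders of rank n, and the cylinder estimate is summed over them. The intended
    E are the events kappa^n g = h. *)
Lemma saturated_distortion n (E B : set X) : measurable E -> measurable B ->
  (forall w, size w = n -> cyl w `<=` E \/ E `&` cyl w = set0) ->
  mu (E `&` iter n theta @^-1` B) <= K%:E * (mu E * mu B) /\
  mu E * mu B <= K%:E * mu (E `&` iter n theta @^-1` B).
Proof.
move=> mE mB sat.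
have mT := measurable_iter_preimage mm n mB.
have mc (w : n.-tuple I) : measurable (cyl w) by exact: (measurable_cyl mm).
have part A : measurable A -> mu A = \esum_(w in [set: n.-tuple I]) mu (A `&` cyl w).
  exact: (measure_partition mu (cyl_trivIset mm (n := n)) (cyl_cover mm n) mc).
have [E1 E2] : mu E = \esum_(w in [set: n.-tuple I]) mu (E `&` cyl w) /\
  mu (E `&` iter n theta @^-1` B) = \esum_(w in [set: n.-tuple I])
    mu (E `&` iter n theta @^-1` B `&` cyl w).
  by split; apply: part => //; exact: measurableI.
have dist (w : n.-tuple I) :
    mu (E `&` iter n theta @^-1` B `&` cyl w) <= K%:E * (mu (E `&` cyl w) * mu B) /\
    mu (E `&` cyl w) * mu B <= K%:E * mu (E `&` iter n theta @^-1` B `&` cyl w).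
  rewrite setIAC; have [cE|->] := sat _ (size_tuple w); last first.
    by rewrite set0I measure0 mul0e mule0.
  rewrite (setIidr cE); have := cyl_distortion w mB.
  by rewrite size_tuple.
rewrite E1 E2 -esumZr//; split.
  rewrite -esumZl; [|by rewrite lee_fin|by move=> w; rewrite mule_ge0].
  by apply: le_esum => w _; case: (dist w).
rewrite -esumZl//.
by apply: le_esum => w _; case: (dist w).
Qed.

End distortion.
End gibbs.

(** * Transfer operator and the kernel of the extension *)
Section countable_fibers.
Context {R : realType} {d} {X : measurableType d} {V : countType}.

Lemma pinv_notin T U (dflt : U -> T) (A : set T) (f : T -> U) y :
  ~ (f @` A) y -> 'pinv_dflt A f y = dflt y.
Proof. by move=> nfy; rewrite /pinv_ splitV oinv_surj; case: pselect. Qed.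

Lemma bij_pinvE T (f : T -> T) x y : bijective f ->
  (x = 'pinv_id setT f y) <-> (f x = y).
Proof.
move=> bf; split=> [->|<-].
  apply: pinvK; rewrite inE; have [g _ gK] := bf.
  by exists (g y).
rewrite pinvKV ?inE// => u v _ _; exact: bij_inj.
Qed.

(** On B = {f >= c + e} the hypothesis gives (c + e) mu B <= c mu B, so B is null; e runs through
    1/(k+1). *)
Lemma ae_le_of_integral (mu : {finite_measure set X -> \bar R})
    (f : X -> \bar R) (c : R) :
  measurable_fun setT f -> (forall x, 0 <= f x) -> (0 <= c)%R ->
  (forall B, measurable B -> \int[mu]_(x in B) f x <= c%:E * mu B) ->
  \forall x \ae mu, f x <= c%:E.
Proof.
move=> mf f0 c0 H.
have key (k : nat) : \forall x \ae mu, f x < (c + k.+1%:R^-1)%R%:E.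
  pose e : R := (k.+1%:R^-1)%R; have e0 : (0 < e)%R by rewrite invr_gt0.
  pose B := [set x | (c + e)%R%:E <= f x].
  have mB : measurable B.
    by rewrite -[B]setTI; exact: (emeasurable_fun_c_infty measurableT mf).
  have muBf : mu B \is a fin_num by exact: fin_num_measure.
  have : (c + e)%R%:E * mu B <= c%:E * mu B.
    apply: le_trans (H B mB); rewrite -integral_cst//.
    apply: ge0_le_integral => //.
    - by move=> x _; rewrite lee_fin addr_ge0// ltW.
    - exact: measurable_funTS.
  rewrite -(fineK muBf) -!EFinM lee_fin => le.
  have m0 : (0 <= fine (mu B))%R by rewrite fine_ge0.
  have : fine (mu B) = 0%R by nra.
  move=> muB0; exists B; split => //; first by rewrite -(fineK muBf) muB0.
  by move=> x /= /negP; rewrite -leNgt.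
have {}key := ae_foralln key.
apply: filterS key => x fx.
have fxf : f x \is a fin_num by rewrite ge0_fin_numE// (lt_trans (fx 0%N))// ltry.
rewrite -(fineK fxf) lee_fin; apply/ler_addgt0Pr => e e0.
have [k ke] : exists k, (k.+1%:R^-1 < e)%R.
  by exists (Num.truncn e^-1); rewrite invf_plt ?posrE// truncnS_gt.
have := fx k; rewrite -{1}(fineK fxf) lte_fin => /ltW/le_trans; apply.
by rewrite lerD2l ltW.
Qed.

Lemma ae_forall_countable (mu : {measure set X -> \bar R})
    (P : V -> X -> Prop) :
  (forall v, \forall x \ae mu, P v x) -> \forall x \ae mu, forall v, P v x.
Proof.
move=> H; have : forall n, \forall x \ae mu,
    if pickle_inv n is Some v then P v x else True.
  by move=> n; case: (pickle_inv n) => [v|]; [exact: H|exact: aeW].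
move=> /ae_foralln; apply: filterS => x Px v.
by have := Px (pickle v); rewrite pickleK_inv.
Qed.

End countable_fibers.

(** * The n-step kernel on the vertices *)

Section extension_kernel.
Context {R : realType} {d} {X : measurableType d} (mu : probability X R).
Context {I : countType} (cell : I -> set X) (theta : X -> X).
Context (phi : seq I -> X -> R).
Hypothesis gm : gibbs_markov_full mu cell theta phi.
Context {V : countType} (E : V -> V -> Prop) (kappa : X -> V -> V).
Hypothesis nc : nn_cocycle cell kappa E.
Context (K : R).
Hypothesis K1 : (1 <= K)%R.
Hypothesis osc : forall w, w != [::] -> \forall x \ae mu, \forall y \ae mu,
  (phi w x <= K * phi w y)%R /\ (phi w y <= K * phi w x)%R.
Local Notation cyl := (cyl cell theta).
Local Notation kappan := (kappan theta kappa).

Let mm := gm_markov gm.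
Let full := gm_full gm.

Lemma kappanSr n x g : kappan n.+1 x g = kappan n (theta x) (kappa x g).
Proof. by elim: n => //= n <-; rewrite -iterSr. Qed.

Lemma kappanD m n x g : kappan (m + n) x g = kappan n (iter m theta x) (kappan m x g).
Proof. by elim: n => [|n IH]; rewrite ?addn0// addnS /= IH addnC iterD. Qed.

Lemma kappan_bij n x : bijective (kappan n x).
Proof.
elim: n => [|n IH] /=; first by exists id.
by apply: (@bij_comp _ _ _ (kappa _)); [exact: (kappa_bij nc)|].
Qed.

Lemma kappan_cyl w x y : cyl w x -> cyl w y -> kappan (size w) x = kappan (size w) y.
Proof.
elim: w x y => [|i w IH] x y // [ix wx] [iy wy]; apply/funext => g.
by rewrite /size -/size !kappanSr (kappa_const nc ix iy) (IH _ _ wx wy).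
Qed.

Definition level n g h : set X := [set x | kappan n x g = h].

(** The first n letters of x determine the maps kappa composed in kappa^n. *)
Lemma level_saturated n g h w : size w = n ->
  cyl w `<=` level n g h \/ level n g h `&` cyl w = set0.
Proof.
move=> <-; have [[x [xh wx]]|no] := pselect (level (size w) g h `&` cyl w !=set0).
  by left=> y wy; rewrite /level /= (kappan_cyl wy wx).
by right; apply/seteqP; split=> // x xx; apply: no; exists x.
Qed.

Lemma measurable_level n g h : measurable (level n g h).
Proof.
rewrite -[level n g h]setIT -(cyl_cover mm n) setI_bigcupr.
apply: countable_bigcupT_measurable => // w.
have [wl|->] := level_saturated g h (size_tuple w); last exact: measurable0.
by rewrite setIidr//; exact: (measurable_cyl mm).
Qed.

Lemma level_trivIset_codom n g : trivIset setT (level n g).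
Proof. by move=> h k _ _ [x [/= <- <-]]. Qed.

Lemma level_cover_codom n g : \bigcup_h level n g h = setT.
Proof. by rewrite -subTset => x _; exists (kappan n x g). Qed.

(** Injectivity of kappa^n_x; with surjectivity it makes the events a partition in the source vertex
    as well, whence column sums equal to 1. *)
Lemma level_trivIset_dom n h : trivIset setT (fun g => level n g h).
Proof. by move=> g k _ _ [x [/= <-]] /esym/(bij_inj (kappan_bij n x)). Qed.

Lemma level_cover_dom n h : \bigcup_g level n g h = setT.
Proof.
rewrite -subTset => x _; have [f _ fK] := kappan_bij n x.
by exists (f h) => //; exact: fK.
Qed.

Definition walk_kernel n g h : \bar R := mu (level n g h).

Lemma walk_kernel_ge0 n g h : 0 <= walk_kernel n g h.
Proof. exact: measure_ge0. Qed.

Lemma walk_kernel_le1 n g h : walk_kernel n g h <= 1.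
Proof. exact: probability_le1 (measurable_level _ _ _). Qed.

Lemma walk_kernel_row n g : \esum_(h in [set: V]) walk_kernel n g h = 1.
Proof.
rewrite -(probability_setT mu) (measure_partition mu (@level_trivIset_codom n g)
  (level_cover_codom n g) (measurable_level n g) measurableT).
by apply: eq_esum => h _; rewrite setTI.
Qed.

Lemma walk_kernel_col n h : \esum_(g in [set: V]) walk_kernel n g h = 1.
Proof.
rewrite -(probability_setT mu) (measure_partition mu (@level_trivIset_dom n h)
  (level_cover_dom n h) (fun g => measurable_level n g h) measurableT).
by apply: eq_esum => g _; rewrite setTI.
Qed.

Lemma walk_kernel_l2_bound n : l2_bound (walk_kernel n) 1.
Proof.
rewrite -[1%R]mulr1; apply: (@schur_test _ _ _ (fun=> 1%R)) => //.
- by move=> g; under eq_esum do rewrite mule1; rewrite walk_kernel_col mule1.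
- by move=> h; under eq_esum do rewrite mule1; rewrite walk_kernel_row mule1.
Qed.

Lemma level_add m n g f h : level (m + n) g h `&` level m g f =
  level m g f `&` iter m theta @^-1` level n f h.
Proof.
apply/seteqP; split=> x; rewrite /level /= kappanD.
  by move=> [gh gf]; rewrite -gf.
by move=> [gf fh]; rewrite gf.
Qed.

(** The event is split according to the vertex f reached at time m; the past is saturated by
    cylinders of rank m, so distortion decouples it from the future. *)
Lemma walk_kernelD_le m n g h : walk_kernel (m + n) g h <=
  K%:E * \esum_(f in [set: V]) walk_kernel m g f * walk_kernel n f h.
Proof.
rewrite -esumZl; [|by rewrite lee_fin (le_trans ler01)|by move=> f; rewrite mule_ge0].
rewrite {1}/walk_kernel (measure_partition mu (@level_trivIset_codom m g)
  (level_cover_codom m g) (measurable_level m g) (measurable_level _ _ _)).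
apply: le_esum => f _; rewrite level_add.
by apply: (proj1 (saturated_distortion gm K1 osc _ _ _));
  [exact: measurable_level|exact: measurable_level|exact: level_saturated].
Qed.

Lemma walk_kernelD_ge m n g h :
  \esum_(f in [set: V]) walk_kernel m g f * walk_kernel n f h <=
  K%:E * walk_kernel (m + n) g h.
Proof.
rewrite {3}/walk_kernel (measure_partition mu (@level_trivIset_codom m g)
  (level_cover_codom m g) (measurable_level m g) (measurable_level _ _ _)).
rewrite -esumZl; [|by rewrite lee_fin (le_trans ler01)|by []].
apply: le_esum => f _; rewrite level_add.
by apply: (proj2 (saturated_distortion gm K1 osc _ _ _));
  [exact: measurable_level|exact: measurable_level|exact: level_saturated].
Qed.

Lemma iter_extension k x g : iter k (extension theta kappa) (x, g) =
  (iter k theta x, kappan k x g).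
Proof. by elim: k => //= k ->. Qed.

(** Transitivity concerns the measure of a forward image, so a null event must be shown to be empty.
    It is: a nonempty one contains a whole cylinder, of positive measure. *)
Lemma walk_kernel_trans : top_transitive mu cell theta kappa ->
  forall g h, exists k, 0 < walk_kernel k g h.
Proof.
(* A letter exists because the cells cover a space of measure 1. *)
move=> tt g h; have [i _] : exists i : I, True.
  apply: contrapT => noI.
  have : mu setT = 0.
    rewrite -(cell_cover mm) (_ : \bigcup_a cell a = set0) ?measure0//.
    by rewrite -subset0 => x [i _ _]; apply: noI; exists i.
  by rewrite probability_setT => /eqP; rewrite onee_eq0.
have [k k0 pos] := tt i i g h; exists k.
rewrite lt0e walk_kernel_ge0 andbT; apply/eqP => null; move: pos.
have E0 : level k g h = set0.
  rewrite -subset0 => x xgh.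
  have [w _ wx] : (\bigcup_(w : k.-tuple I) cyl w) x by rewrite (cyl_cover mm).
  have [sub|dis] := level_saturated g h (size_tuple w); last first.
    by rewrite -dis; split.
  have := cyl_gt0 mm full w; rewrite lt0e => /andP[/eqP]; case.
  exact: (subset_measure0 (measurable_cyl mm w) (measurable_level _ _ _) sub null).
suff -> : (iter k (extension theta kappa) @` (cell i `*` [set g])) `&`
    (cell i `*` [set h]) = set0.
  rewrite /mu_counting integral0_eq ?ltxx// => x _.
  by rewrite xsection0 /counting asboolT// fset_set0.
rewrite -subset0 => z /= [[[x f] [/= ix ->] <-]]; rewrite iter_extension => -[_ /= kh].
by have : level k g h x by []; rewrite E0.
Qed.

End extension_kernel.

(** * Duality for the transfer operator *)
Section transfer_operator.
Context {R : realType} {d} {X : measurableType d} (mu : probability X R).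
Context {I : countType} (cell : I -> set X) (theta : X -> X).
Context (phi : seq I -> X -> R).
Hypothesis gm : gibbs_markov_full mu cell theta phi.
Context {V : countType} (E : V -> V -> Prop) (kappa : X -> V -> V).
Hypothesis nc : nn_cocycle cell kappa E.
Local Notation cyl := (cyl cell theta).
Local Notation tau := (tau cell theta).
Local Notation level := (level theta kappa).

Let mm := gm_markov gm.
Let full := gm_full gm.

Lemma tau_cellK i x : cell i x -> tau [:: i] (theta x) = x.
Proof. by move=> ix; apply: (tauK mm (w := [:: i])); split. Qed.

(** Preimages are images under theta^n inside theta^n[w], and [tau] is the identity elsewhere. *)
Lemma measurable_tau w : measurable_fun setT (tau w).
Proof.
move=> _ B mB; rewrite setTI.
have mD : measurable (iter (size w) theta @` cyl w).
  by apply: (iter_image_measurable mm) => //; exact: (measurable_cyl mm).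
have -> : tau w @^-1` B = iter (size w) theta @` (B `&` cyl w) `|`
    (B `\` iter (size w) theta @` cyl w).
  apply/seteqP; split=> [y By|y [[x [Bx wx] <-]|[By nwy]]].
  - have [[x wx xy]|nwy] := pselect ((iter (size w) theta @` cyl w) y).
      left; exists x => //; split=> //.
      by move: By; rewrite /preimage /= -xy (tauK mm).
    by right; split=> //; move: By; rewrite /preimage /= /tau pinv_notin.
  - by rewrite /preimage /= (tauK mm).
  - by rewrite /preimage /= /tau pinv_notin.
apply: measurableU; last exact: measurableD.
apply: (iter_image_measurable mm); last by move=> x [].
by apply: measurableI => //; exact: (measurable_cyl mm).
Qed.

Definition letter_inv i (g : V) : V := 'pinv_id setT (kappa_letter cell kappa i) g.

Lemma letter_invE i x h g : cell i x -> (h = letter_inv i g) <-> (kappa x h = g).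
Proof.
move=> ix; have kE : kappa_letter cell kappa i = kappa x.
  apply/funext => f; apply: xget_subset1; first by exists x.
  by move=> _ _ [y iy <-] [z iz <-]; rewrite (kappa_const nc iy iz).
by rewrite /letter_inv kE; apply: bij_pinvE; exact: (kappa_bij nc).
Qed.

(** The transfer operator with values in [0, +oo]: for nonnegative functions sums need no
    convergence and may be exchanged with integrals. *)
Definition etransfer (F : X * V -> \bar R) (z : X * V) : \bar R :=
  \esum_(i in [set: I]) (phi [:: i] z.1)%:E * F (tau [:: i] z.1, letter_inv i z.2).

Definition sections_measurable (F : X * V -> \bar R) : Prop :=
  forall g, measurable_fun setT (fun x => F (x, g)).

Let phi0 i x : (0 <= phi [:: i] x)%R. Proof. exact: (phi_ge0 gm). Qed.

Lemma measurable_branch F i g : sections_measurable F ->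
  measurable_fun setT (fun x => (phi [:: i] x)%:E * F (tau [:: i] x, g)).
Proof.
move=> mF; apply: emeasurable_funM.
  by apply/measurable_EFinP; exact: (measurable_phi gm).
exact: (measurableT_comp (mF g) (measurable_tau _)).
Qed.

Lemma etransfer_ge0 F z : (forall z, 0 <= F z) -> 0 <= etransfer F z.
Proof. by move=> F0; apply: esum_ge0 => i _; rewrite mule_ge0// lee_fin. Qed.

Lemma iter_etransfer_ge0 n F z : (forall z, 0 <= F z) -> 0 <= iter n etransfer F z.
Proof. by move=> F0; elim: n z => //= n IH z; exact: etransfer_ge0. Qed.

Lemma measurable_etransfer F : (forall z, 0 <= F z) -> sections_measurable F ->
  sections_measurable (etransfer F).
Proof.
move=> F0 mF g; apply: emeasurable_esum => [i x|i].
  by rewrite mule_ge0// lee_fin.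
exact: (measurable_branch i (letter_inv i g) mF).
Qed.

Lemma measurable_iter_etransfer n F : (forall z, 0 <= F z) ->
  sections_measurable F -> sections_measurable (iter n etransfer F).
Proof.
move=> F0 mF; elim: n => //= n IH; apply: measurable_etransfer IH => z.
exact: iter_etransfer_ge0.
Qed.

(** Change of variables along one branch: phi_i dmu is the image under theta of mu on cell i, and
    tau_i inverts theta there. *)
Lemma integral_branch i (F H : X -> \bar R) : (forall x, 0 <= F x) ->
  (forall x, 0 <= H x) -> measurable_fun setT F -> measurable_fun setT H ->
  \int[mu]_x ((phi [:: i] x)%:E * F (tau [:: i] x) * H x) =
  \int[mu]_x (F x * ((\1_(cell i) x)%:E * H (theta x))).
Proof.
move=> F0 H0 mF mH; have mci := cell_measurable mm i.
pose G x := F (tau [:: i] x) * H x.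
have mG : measurable_fun setT G.
  by apply: emeasurable_funM => //; exact: (measurableT_comp mF (measurable_tau _)).
have := @eq_weighted_integral _ _ _ mu (phi [:: i]) \1_(cell i) id theta G.
move=> /(_ _ _ _ _ _ _ _ _ mG) eqG.
transitivity (\int[mu]_x ((\1_(cell i) x)%:E * G (theta x))).
  under eq_integral do rewrite -muleA.
  apply: eqG.
  - exact: phi0.
  - by [].
  - exact: (measurable_phi gm).
  - by [].
  - exact: measurable_id.
  - exact: (measurable_theta mm).
  - move=> B mB.
    transitivity (\int[mu]_(x in B) (phi [:: i] x)%:E).
      by rewrite [RHS]integral_mkcond; apply: eq_integral => x _; rewrite epatch_indic.
    rewrite (integral_phi gm)//= preimage_setT setIT -[X in mu X]setIT.
    rewrite -integral_indic//; last first.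
      exact: (measurable_cell_preimage mm).
    by apply: eq_integral => x _; rewrite indicI.
  - by move=> x; rewrite mule_ge0.
apply: eq_integral => x _; rewrite indicE; have [|_] := boolP (x \in cell i).
  by rewrite inE => ix; rewrite /G tau_cellK// !mul1e.
by rewrite !mul0e mule0.
Qed.

Lemma letter_inv_level n i h g y : cell i (iter n theta y) ->
  level n h (letter_inv i g) y <-> level n.+1 h g y.
Proof. by move=> iy; exact: letter_invE. Qed.

(** The test function H is left arbitrary for the induction: one step of duality replaces it by
    1_(cell i) times H o theta, to which the hypothesis applies. *)
Lemma integral_iter_etransfer n F H g : (forall z, 0 <= F z) ->
  sections_measurable F -> (forall x, 0 <= H x) -> measurable_fun setT H ->
  \int[mu]_x (iter n etransfer F (x, g) * H x) =
  \esum_(h in [set: V]) \int[mu]_(y in level n h g) (F (y, h) * H (iter n theta y)).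
Proof.
move=> F0 mF; elim: n H g => [|n IH] H g H0 mH.
  rewrite (@esum_single _ _ g).
  - by rewrite [level _ _ _](_ : _ = setT)//; apply/seteqP.
  - by apply: integral_ge0 => x _; rewrite mule_ge0.
  - move=> h hg; rewrite [level _ _ _](_ : _ = set0) ?integral_set0//.
    by rewrite -subset0 => x; exact: hg.
rewrite iterS; set F' := iter n etransfer F.
have F'0 z : 0 <= F' z by exact: iter_etransfer_ge0.
have mF' : sections_measurable F' by exact: measurable_iter_etransfer.
have mi i : measurable_fun setT (fun x => (\1_(cell i) x)%:E : \bar R).
  by apply/measurable_EFinP; apply: measurable_indic; exact: (cell_measurable mm).
have mHt : measurable_fun setT (H \o theta).
  exact: (measurableT_comp mH (measurable_theta mm)).
transitivity (\esum_(i in [set: I]) \int[mu]_x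
    (F' (x, letter_inv i g) * ((\1_(cell i) x)%:E * H (theta x)))).
  transitivity (\int[mu]_x \esum_(i in [set: I])
      ((phi [:: i] x)%:E * F' (tau [:: i] x, letter_inv i g) * H x)).
    apply: eq_integral => x _; rewrite esumZr// => i.
    by rewrite mule_ge0// lee_fin.
  rewrite integral_esum.
  - apply: eq_esum => i _.
    by apply: (@integral_branch i (fun x => F' (x, letter_inv i g))).
  - by move=> i x; rewrite !mule_ge0// lee_fin.
  - move=> i; apply: emeasurable_funM => //.
    exact: (measurable_branch i (letter_inv i g) mF').
transitivity (\esum_(i in [set: I]) \esum_(h in [set: V])
    \int[mu]_(y in level n h (letter_inv i g)) (F (y, h) *
      ((\1_(cell i) (iter n theta y))%:E * H (theta (iter n theta y))))).
  apply: eq_esum => i _; apply: (IH (fun x => (\1_(cell i) x)%:E * H (theta x))).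
    by move=> x; rewrite mule_ge0// lee_fin.
  exact: emeasurable_funM.
rewrite exchange_esum; last first.
  by move=> i h; apply: integral_ge0 => x _; rewrite !mule_ge0// lee_fin.
apply: eq_esum => h _; rewrite [RHS]integral_mkcond.
(* Where theta^n y lies in cell i, reaching the i-th preimage of g in n steps means reaching g in n
   + 1 steps. The sum over i thus reassembles the level set of time n + 1. *)
pose P i := iter n theta @^-1` cell i.
have mP i : measurable (P i).
  by apply: (measurable_iter_preimage mm); exact: (cell_measurable mm).
rewrite (@integral_partition _ _ _ mu _ P)//.
- apply: eq_esum => i _; rewrite [LHS]integral_mkcond [RHS]integral_mkcond.
  apply: eq_integral => y _; rewrite !patchE indicE.
  have [|nPy] := boolP (y \in P i).
    rewrite inE => Py; rewrite (_ : _ \in cell i) ?mul1e; last by rewrite inE.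
    by have -> : (y \in level n h (letter_inv i g)) = (y \in level n.+1 h g);
      [apply/idP/idP; rewrite !inE => /(letter_inv_level h g Py)|].
  rewrite (_ : (_ \in cell i) = false); last first.
    by apply: memNset; move: nPy; rewrite notin_setE.
  by rewrite mul0e mule0; case: ifP.
- by move=> i j _ _ [y [iy jy]]; apply: (cell_disjoint mm) => //; exists (iter n theta y).
- rewrite -subTset => y _; have [i _ iy] : (\bigcup_a cell a) (iter n theta y).
    by rewrite (cell_cover mm).
  by exists i.
- by move=> y; rewrite patchE; case: ifP => // _; rewrite mule_ge0.
- apply/(measurable_restrictT _ _).1; first exact: (measurable_level gm nc).
  apply: measurable_funTS; apply: emeasurable_funM => //.
  exact: (measurableT_comp mH (measurable_iter_theta mm n.+1)).
Qed.

Lemma integral_iter_etransfer_fiber n F g (B : set X) : (forall z, 0 <= F z) ->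
  sections_measurable F -> measurable B ->
  \int[mu]_(x in B) iter n etransfer F (x, g) =
  \esum_(h in [set: V])
    \int[mu]_(y in level n h g `&` iter n theta @^-1` B) F (y, h).
Proof.
move=> F0 mF mB; transitivity (\int[mu]_x (iter n etransfer F (x, g) * (\1_B x)%:E)).
  by rewrite integral_mkcond; apply: eq_integral => x _; rewrite epatch_indic.
rewrite integral_iter_etransfer//; last by apply/measurable_EFinP.
  apply: eq_esum => h _; rewrite integral_mkcondr; apply: eq_integral => y _.
  rewrite patchE indicE (_ : (_ \in B) = (y \in iter n theta @^-1` B)).
    by case: ifP => _; rewrite ?mule1 ?mule0.
  by apply/idP/idP; rewrite !inE.
Qed.

End transfer_operator.

(** * Comparison of the operator norm with the kernel *)
Section norm_tools.
Context {R : realType} {d} {X : measurableType d} (mu : probability X R).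

Lemma Lnorm_inf_leP (u : X -> \bar R) (c : \bar R) :
  Lnorm mu +oo u <= c <-> \forall x \ae mu, `|u x| <= c.
Proof.
rewrite unlock /= probability_setT lte01.
by split=> [/ess_supP|H]; [|exact/ess_supP].
Qed.

Lemma root2_leP (x : \bar R) (y : R) : 0 <= x -> (0 <= y)%R ->
  (x `^ 2^-1 <= y%:E) = (x <= (y ^+ 2)%:E).
Proof.
move=> + y0; case: x => [r| |]//; last by rewrite poweRyr ?invr_eq0 ?pnatr_eq0// !leye_eq.
rewrite poweR_EFin !lee_fin => r0; rewrite powR12_sqrt//.
apply/idP/idP => H.
  by rewrite -(sqr_sqrtr r0); apply: lerXn2r; rewrite ?nnegrE ?sqrtr_ge0.
by rewrite -(ger0_norm y0) -sqrtr_sqr ler_sqrt// sqr_ge0.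
Qed.

(** Valid for every family: without absolute summability the bound is +oo, and otherwise both parts
    are finite. *)
Lemma rsum_le (I : countType) (a : I -> R) (A : \bar R) :
  \esum_(i in [set: I]) `|a i|%:E <= A -> `|rsum a|%:E <= A.
Proof.
move=> /(le_trans _); apply; rewrite /rsum.
set M := (leRHS).
have pM : \esum_(i in [set: I]) (EFin \o a)^\+ i <= M.
  apply: le_esum => i _; rewrite funeposE /= -EFin_max lee_fin.
  by rewrite ge_max ler_norm normr_ge0.
have nM : \esum_(i in [set: I]) (EFin \o a)^\- i <= M.
  apply: le_esum => i _; rewrite funenegE /= -EFin_max lee_fin.
  by rewrite ge_max normr_ge0 andbT -normrN ler_norm.
have p0 : 0 <= \esum_(i in [set: I]) (EFin \o a)^\+ i by apply: esum_ge0.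
have n0 : 0 <= \esum_(i in [set: I]) (EFin \o a)^\- i by apply: esum_ge0.
have [->|Moo] := eqVneq M +oo; first by rewrite leey.
move: pM nM p0 n0; set P := esum _ _; set N := esum _ _.
have Mf : M \is a fin_num by rewrite ge0_fin_numE ?ltey//; exact: esum_ge0.
rewrite -(fineK Mf).
case: P => [p| |]//; case: N => [n| |]//=; rewrite !lee_fin => *.
by rewrite ler_norml; apply/andP; split; lra.
Qed.

Lemma rsum_ge0 (I : countType) (a : I -> R) (f : I -> \bar R) :
  (forall i, (a i)%:E = f i) -> (forall i, 0 <= f i) ->
  \esum_(i in [set: I]) f i < +oo ->
  (rsum a)%:E = \esum_(i in [set: I]) f i.
Proof.
move=> af f0 foo; have a0 i : (0 <= a i)%R by rewrite -lee_fin af.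
rewrite /rsum [X in _ - X]esum1 ?sube0; last first.
  by move=> i _; rewrite funenegE; apply/max_idPr; rewrite leeNl oppe0 lee_fin.
have -> : \esum_(i in [set: I]) (EFin \o a)^\+ i = \esum_(i in [set: I]) f i.
  by apply: eq_esum => i _; rewrite funeposE -af; apply/max_idPl; rewrite lee_fin.
by rewrite fineK// ge0_fin_numE//; exact: esum_ge0.
Qed.

End norm_tools.

Section norm_comparison.
Context {R : realType} {d} {X : measurableType d} (mu : probability X R).
Context {I : countType} (cell : I -> set X) (theta : X -> X).
Context (phi : seq I -> X -> R).
Hypothesis gm : gibbs_markov_full mu cell theta phi.
Context {V : countType} (E : V -> V -> Prop) (kappa : X -> V -> V).
Hypothesis nc : nn_cocycle cell kappa E.
Context (K : R).
Hypothesis K1 : (1 <= K)%R.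
Hypothesis osc : forall w, w != [::] -> \forall x \ae mu, \forall y \ae mu,
  (phi w x <= K * phi w y)%R /\ (phi w y <= K * phi w x)%R.
Local Notation level := (level theta kappa).
Local Notation walk := (walk_kernel mu theta kappa).
Local Notation S := (etransfer cell theta phi kappa).
Local Notation T := (transfer cell theta kappa phi).

Let mm := gm_markov gm.
Let K0 : (0 <= K)%R. Proof. exact: le_trans ler01 K1. Qed.
Let phi0 i x : (0 <= phi [:: i] x)%R. Proof. exact: (phi_ge0 gm). Qed.

(** Duality with the indicator of B, together with distortion of the level sets, bounds the integral
    over B by K c mu B. *)
Lemma iter_etransfer_ae_le n (F : X * V -> \bar R) (a : V -> \bar R) g (c : R) :
  (forall z, 0 <= F z) -> sections_measurable F -> (forall h, 0 <= a h) ->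
  (forall h, \forall y \ae mu, F (y, h) <= a h) ->
  kernel_act (walk n) a g <= c%:E ->
  \forall x \ae mu, iter n S F (x, g) <= (K * c)%:E.
Proof.
move=> F0 mF a0 Fa ac.
have c0 : (0 <= c)%R.
  by rewrite -lee_fin (le_trans _ ac)// kernel_act_ge0// => *; exact: walk_kernel_ge0.
apply: ae_le_of_integral.
- exact: (measurable_iter_etransfer gm).
- by move=> x; exact: (iter_etransfer_ge0 gm).
- exact: mulr_ge0.
move=> B mB; rewrite (integral_iter_etransfer_fiber gm nc)//.
have mL h : measurable (level n h g `&` iter n theta @^-1` B).
  apply: measurableI; first exact: (measurable_level gm nc).
  exact: (measurable_iter_preimage mm).
apply: (@le_trans _ _ (\esum_(h in [set: V])
    a h * (K%:E * (walk n h g * mu B)))).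
  apply: le_esum => h _; apply: (@le_trans _ _
      (a h * mu (level n h g `&` iter n theta @^-1` B))).
    rewrite -integral_cst//; apply: ae_ge0_le_integral => //.
    - by apply: measurable_funTS; exact: mF.
    - by move=> x _; exact: a0.
    - by apply: filterS (Fa h) => y Fy _.
  apply: lee_wpmul2l => //.
  by apply: (proj1 (saturated_distortion gm K1 osc _ mB _));
    [exact: (measurable_level gm nc)|exact: (level_saturated theta nc)].
apply: (@le_trans _ _ (K%:E * mu B * kernel_act (walk n) a g)).
  rewrite /kernel_act -esumZl.
  - apply: le_esum => h _; rewrite muleCA -[leRHS]muleA.
    by rewrite (muleA (a h)) (muleC (a h)) (muleC (mu B)).
  - by rewrite mule_ge0// lee_fin.
  - by move=> h; rewrite mule_ge0// walk_kernel_ge0.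
apply: (le_trans (lee_wpmul2l _ ac)); first by rewrite mule_ge0// lee_fin.
by rewrite EFinM muleAC.
Qed.

Lemma iter_transfer_le n (f : X * V -> R) z :
  `|iter n T f z|%:E <= iter n S (fun z => `|f z|%:E) z.
Proof.
elim: n z => [|n IH] z //=; apply: rsum_le; apply: le_esum => i _.
rewrite normrM (ger0_norm (phi0 i z.1)) EFinM.
by apply: lee_wpmul2l; [rewrite lee_fin|exact: IH].
Qed.

Let Hnorm_sqnorm (f : X * V -> R) : Hnorm mu f =
  sqnorm (fun g => Lnorm mu +oo (fun x => (f (x, g))%:E)) `^ 2^-1.
Proof. by []. Qed.

Lemma op_norm_le n (c : R) : (0 <= c)%R -> l2_bound (walk n) c ->
  op_norm mu (iter n T) <= (K * Num.sqrt c)%:E.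
Proof.
move=> c0 B; apply: ge_ereal_sup => _ [f [[mf _] /= f1] <-].
pose a h := Lnorm mu +oo (fun x => (f (x, h))%:E).
have a0 h : 0 <= a h by exact: Lnorm_ge0.
have a1 : sqnorm a <= 1.
  by move: f1; rewrite Hnorm_sqnorm root2_leP ?sqnorm_ge0// expr1n.
have aE : a = EFin \o (fine \o a).
  apply/funext => h /=; rewrite fineK// (sqnorm_fin_num _ a0)//.
  by rewrite (le_lt_trans a1)// ltry.
have fa0 h : (0 <= (fine \o a) h)%R by rewrite fine_ge0.
rewrite aE in a1; have := B _ fa0 (le_lt_trans a1 (ltry 1)).
rewrite -aE in a1 *; set b := kernel_act (walk n) a => bc.
have b0 g : 0 <= b g by apply: kernel_act_ge0 => // *; exact: walk_kernel_ge0.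
have {}bc : sqnorm b <= c%:E.
  by rewrite (le_trans bc)// -[leRHS]mule1 lee_wpmul2l// lee_fin.
have bf g : b g \is a fin_num.
  by rewrite (sqnorm_fin_num _ b0)// (le_lt_trans bc)// ltry.
rewrite Hnorm_sqnorm root2_leP ?sqnorm_ge0 ?mulr_ge0 ?sqrtr_ge0//.
apply: (@le_trans _ _ (sqnorm (fun g => K%:E * b g))).
  apply: le_sqnorm => g; first exact: Lnorm_ge0.
  apply/Lnorm_inf_leP; rewrite -(fineK (bf g)) -EFinM.
  have : \forall x \ae mu,
      iter n S (fun z => `|f z|%:E) (x, g) <= (K * fine (b g))%:E.
    apply: (@iter_etransfer_ae_le _ _ a) => //.
    - by move=> h; apply/measurable_EFinP; exact: measurableT_comp.
    - by move=> h; exact: (proj1 (Lnorm_inf_leP mu _ _) (lexx (a h))).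
    - by rewrite fineK.
  by apply: filterS => x; apply: le_trans; exact: iter_transfer_le.
rewrite sqnormZ exprMn sqr_sqrtr// (EFinM (K ^+ 2)); apply: lee_wpmul2l => //.
by rewrite lee_fin sqr_ge0.
Qed.

(** Equality may fail where the extended sum is infinite, since [fine] then returns 0, and where an
    inverse branch hits the exceptional set of the previous step. Both sets are null. *)
Lemma iter_transferE n (f : X * V -> R) g : (forall z, (0 <= f z <= 1)%R) ->
  sections_measurable (EFin \o f) ->
  \forall x \ae mu, (iter n T f (x, g))%:E = iter n S (EFin \o f) (x, g).
Proof.
move=> f01 mf; have F0 z : 0 <= (EFin \o f) z by rewrite lee_fin; case/andP: (f01 z).
elim: n g => [|n IH] g; first exact: aeW.
have finite : \forall x \ae mu, iter n.+1 S (EFin \o f) (x, g) < +oo.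
  have : \forall x \ae mu, iter n.+1 S (EFin \o f) (x, g) <= (K * 1)%:E.
    apply: (@iter_etransfer_ae_le _ _ (fun=> 1)) => //.
    - by move=> h; apply: aeW => y; rewrite lee_fin; case/andP: (f01 (y, h)).
    - rewrite /kernel_act; under eq_esum do rewrite mule1.
      by rewrite (walk_kernel_col gm nc).
  by apply: filterS => x /le_lt_trans; apply; rewrite ltry.
have branch : \forall x \ae mu, forall i,
    (phi [:: i] x)%:E * (iter n T f (tau cell theta [:: i] x, letter_inv cell kappa i g))%:E =
    (phi [:: i] x)%:E * iter n S (EFin \o f) (tau cell theta [:: i] x, letter_inv cell kappa i g).
  apply: ae_forall_countable => i.
  have [N [mN N0 subN]] := IH (letter_inv cell kappa i g).
  (* By duality this integral is at most mu N. So almost everywhere tau_i x avoids N, or phi_i x = 0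
     and both sides vanish. *)
  have : \int[mu]_x ((phi [:: i] x)%:E * (\1_N (tau cell theta [:: i] x))%:E) = 0.
    under eq_integral do rewrite -[_ * _]mule1.
    rewrite (@integral_branch _ _ _ mu _ cell theta phi gm i (fun x => (\1_N x)%:E) (cst 1))//.
    - apply/eqP; rewrite eq_le; apply/andP; split; last first.
        by apply: integral_ge0 => x _; rewrite !mule_ge0// lee_fin.
      rewrite -N0 -[X in mu X]setIT -integral_indic//.
      apply: ge0_le_integral => //.
      + by move=> x _; rewrite !mule_ge0// lee_fin.
      + apply: emeasurable_funM; first by apply/measurable_EFinP.
        apply: emeasurable_funM => //; apply/measurable_EFinP.
        by apply: measurable_indic; exact: (cell_measurable mm).
      + by apply/measurable_EFinP.
      + by move=> x _; rewrite mule1 -EFinM lee_fin ler_piMr.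
    - by apply/measurable_EFinP.
  move=> int0.
  have meas : measurable_fun setT
      (fun x => (phi [:: i] x)%:E * (\1_N (tau cell theta [:: i] x))%:E).
    apply: emeasurable_funM; first by apply/measurable_EFinP/(measurable_phi gm).
    apply/measurable_EFinP; apply: measurableT_comp => //.
    exact: (measurable_tau gm).
  have /(ae_eq_integral_abs _ measurableT meas) : \int[mu]_x
      `|(phi [:: i] x)%:E * (\1_N (tau cell theta [:: i] x))%:E| = 0.
    rewrite -int0; apply: eq_integral => x _.
    by rewrite gee0_abs// mule_ge0// lee_fin.
  apply: filterS => x /(_ Logic.I) /eqP.
  rewrite mule_eq0 !eqe => /orP[/eqP ->|].
    by rewrite !mul0e.
  rewrite indicE pnatr_eq0 eqb0 => /negP nN.
  congr (_ * _); apply: contrapT => neq; apply: nN; rewrite inE; exact: subN.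
apply: filterS2 finite branch => x fx bx.
rewrite !iterS; apply: rsum_ge0 => // i.
by rewrite mule_ge0// ?lee_fin// (iter_etransfer_ge0 gm).
Qed.

(** For f(x, g) = a(g) duality makes the kernel action the exact mean of the image on each fibre,
    and a mean is at most the essential supremum. *)
Lemma l2_bound_op_norm n (s : R) : (0 <= s)%R ->
  op_norm mu (iter n T) <= s%:E -> l2_bound (walk n) (s ^+ 2)%R.
Proof.
move=> s0 os; apply: l2_bound_unit_ball => [g h|a a0 a1].
  exact: walk_kernel_ge0.
(* Entries of a vector in the unit ball are at most 1, as [iter_transferE] requires. *)
have a01 h : (0 <= a h <= 1)%R.
  rewrite a0 /=; have := le_trans (sqnorm_ge (EFin \o a) h) a1.
  by rewrite expe2 -EFinM lee_fin -expr2 expr_le1.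
pose f (z : X * V) := a z.2.
have mf : sections_measurable (EFin \o f).
  by move=> g; exact: (measurable_cst (a g)%:E).
have Hf : Hnorm mu f <= 1.
  rewrite Hnorm_sqnorm root2_leP ?sqnorm_ge0// expr1n (le_trans _ a1)//.
  apply: le_sqnorm => g; first exact: Lnorm_ge0.
  by apply/Lnorm_inf_leP; apply: aeW => x; rewrite /f /= lee_fin ger0_norm.
have : Hnorm mu (iter n T f) <= s%:E.
  apply: le_trans os; apply: ereal_sup_ubound; exists f => //; split=> //.
  split; last by rewrite (le_lt_trans Hf)// ltry.
  by move=> g; exact: (measurable_cst (a g)).
rewrite Hnorm_sqnorm root2_leP ?sqnorm_ge0//; apply: le_trans.
apply: le_sqnorm => g.
  apply: kernel_act_ge0 => [*|h]; [exact: walk_kernel_ge0|by rewrite lee_fin].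
set L := Lnorm _ _ _.
have L0 : 0 <= L by exact: Lnorm_ge0.
have F0 z : 0 <= (EFin \o f) z by rewrite /f /= lee_fin.
have -> : kernel_act (walk n) (EFin \o a) g =
    \int[mu]_x iter n S (EFin \o f) (x, g).
  rewrite (integral_iter_etransfer_fiber gm nc)//; apply: eq_esum => h _.
  apply/esym; rewrite preimage_setT setIT muleC.
  exact: (integral_cst mu (measurable_level gm nc n h g) (a h)%:E).
have -> : L = \int[mu]_x (cst L x).
  by rewrite integral_cst// (_ : _ setT = 1) ?mule1//; exact: probability_setT.
apply: ae_ge0_le_integral => //.
- by move=> x _; exact: (iter_etransfer_ge0 gm).
- exact: (measurable_iter_etransfer gm).
have HL : \forall x \ae mu, `|(iter n T f (x, g))%:E| <= L by exact/Lnorm_inf_leP.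
have HE := @iter_transferE n f g (fun z => a01 z.2) mf.
by apply: filterS2 HL HE => x Lx <- _; exact: le_trans (lee_abs _) Lx.
Qed.

End norm_comparison.

(** * From growth of the norms to the spectral radius *)

Lemma limn_esup_le {R : realType} (u : (\bar R)^nat) (v : nat -> R) (l : R) :
  (forall n, u n <= (v n)%:E) -> v n @[n --> \oo] --> l -> limn_esup u <= l%:E.
Proof.
move=> uv vl; apply/lee_addgt0Pr => e e0.
have /cvgrPdist_le/(_ _ e0) near_l := vl.
pose A := [set n | (`|l - v n| <= e)%R].
apply: (@le_trans _ _ (ereal_sup (u @` A))).
  by apply: ereal_inf_lbound; exists A.
apply: ge_ereal_sup => _ [n An <-]; apply: (le_trans (uv n)).
rewrite -EFinD lee_fin -lerBlDl.
by apply: (le_trans (ler_norm _)); rewrite distrC.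
Qed.

Theorem proposition3p7 (R : realType) (d : measure_display)
    (X : measurableType d) (mu : probability X R)
    (I : countType) (cell : I -> set X) (theta : X -> X)
    (phi : seq I -> X -> R)
    (V : countType) (E : V -> V -> Prop) (kappa : X -> V -> V) (o : V) :
  standard_borel R X ->
  gibbs_markov_full mu cell theta phi ->
  invariant_measure mu theta ->
  nn_cocycle cell kappa E ->
  top_transitive mu cell theta kappa ->
  let rho := spectral_radius mu (transfer cell theta kappa phi) in
  return_rate mu theta kappa o <= rho <= 1 /\
  (symmetric_extension mu theta kappa -> rho = return_rate mu theta kappa o).
Proof.
move=> _ gm _ nc tt rho.
have [K K1 osc] := phi_oscillation gm.
have K0 : (0 < K)%R by exact: lt_le_trans ltr01 K1.
set T := transfer cell theta kappa phi in rho *.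
pose p := walk_kernel mu theta kappa.
have p0 n g h : 0 <= p n g h by exact: walk_kernel_ge0.
have opK n : op_norm mu (iter n T) <= K%:E.
  have := op_norm_le gm nc K1 osc ler01 (walk_kernel_l2_bound gm nc n).
  by rewrite sqrtr1 mulr1.
(* The zero function shows that the supremum is over a nonempty set. *)
have op0 n : 0 <= op_norm mu (iter n T).
  have H0 : Hnorm mu (cst 0%R : X * V -> R) = 0.
    rewrite /Hnorm esum1 ?poweR0r// => g _.
    by rewrite Lnorm0// expe2 mule0.
  apply: (@le_trans _ _ (Hnorm mu (iter n T (cst 0%R)))); first exact: poweR_ge0.
  apply: ereal_sup_ubound; exists (cst 0%R) => //=.
  by split; [split=> [g|]; [exact: measurable_cst|]|]; rewrite H0.
pose s n := fine (op_norm mu (iter n T)).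
have sE n : op_norm mu (iter n T) = (s n)%:E.
  by rewrite fineK// ge0_fin_numE// (le_lt_trans (opK n))// ltry.
have s0 n : (0 <= s n)%R by rewrite fine_ge0.
have sK n : (s n <= K)%R by rewrite -lee_fin -sE.
have ps n : l2_bound (p n) (s n ^+ 2)%R.
  by apply: (l2_bound_op_norm gm nc K1 osc) => //; rewrite sE.
have sp n (c : R) : (0 <= c)%R -> l2_bound (p n) c -> (s n <= K * Num.sqrt c)%R.
  by move=> c0 pc; rewrite -lee_fin -sE; exact: (op_norm_le gm nc K1 osc).
(* One factor K comes from composing kernels, the other from returning to the operator norm. *)
have sub m n : (s (m + n)%N <= K ^+ 2 * (s m * s n))%R.
  have := l2_bound_comp (p0 (m + n)%N) (p0 m) (p0 n) (ltW K0) (sqr_ge0 (s n))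
    (fun h g => walk_kernelD_le gm nc K1 osc m n h g) (ps m) (ps n).
  rewrite -!exprMn => /(sp _ _ (sqr_ge0 _)).
  by rewrite sqrtr_sqr ger0_norm ?mulr_ge0 ?(ltW K0)// expr2 -mulrA.
have [l sl] := fekete s0 (exprn_gt0 2 K0) sub.
have rhoE : rho = l%:E.
  rewrite /rho /spectral_radius; apply/cvg_lim => //.
  under eq_fun do rewrite sE poweR_EFin.
  by apply: cvg_EFin => //; exact: nearW.
have poo n : p n o o <= (s n)%:E.
  have := l2_bound_diag o (p0 n) (ps n); have := p0 n o o.
  case: (p n o o) => [x| |]//; rewrite expe2 ?mulyy//= !lee_fin => x0.
  by rewrite -?expr2 ler_pXn2r ?nnegrE.
have Rl : return_rate mu theta kappa o <= l%:E.
  apply: (@limn_esup_le _ _ (fun n => (s n `^ n%:R^-1)%R)) => // n.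
  rewrite -poweR_EFin; apply: gt0_ler_poweR; rewrite ?invr_ge0//.
  - by rewrite in_itv/= leey andbT; exact: p0.
  - by rewrite in_itv/= leey andbT lee_fin.
  - exact: poo.
have l1 : (l <= 1)%R.
  apply: (ler_cvg_to sl (cvg_root K0)); near=> n.
  by apply: le_root.
rewrite rhoE lee_fin Rl l1; split=> // -[C [N [C0 C1 N0 sym]]].
apply/eqP; rewrite eq_le Rl andbT leNgt; apply/negP => Rltl.
(* The midpoint serves when the rate is finite; the value -oo, allowed by the type, is treated
   apart. *)
have [lam Rlam laml] : exists2 lam : R,
    return_rate mu theta kappa o < lam%:E & (lam < l)%R.
  case: (return_rate mu theta kappa o) Rltl => [x| |]//.
    rewrite lte_fin => xl; exists ((x + l) / 2)%R; rewrite ?lte_fin; lra.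
  by move=> _; exists (l - 1)%R; [rewrite ltNyr|lra].
have lam1 : (lam < 1)%R by exact: lt_le_trans l1.
have p1 n g h : p n g h <= 1 by exact: (walk_kernel_le1 gm nc).
have [lam0 go] := root_test_green p0 p1 lam1 Rlam.
have lam01 : (0 < lam < 1)%R by rewrite lam0.
have d0 : (0 < 1 - lam)%R by rewrite subr_gt0.
suff : (l <= lam)%R by rewrite leNgt laml.
(* One K^2 arises from squaring s n <= K sqrt c, the other, with 1 / (1 - lam), from the Schur
   bound. *)
apply: (@symmetric_rate_le _ s C N (K ^+ 2 * (K ^+ 2 / (1 - lam)))%R) => //.
  by rewrite !mulr_gt0 ?exprn_gt0 ?invr_gt0.
move=> n; set Q := (C n * _)%R.
have Q0 : (0 <= Q)%R by rewrite !mulr_ge0 ?exprn_ge0 ?(ltW lam0).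
have := symmetric_l2_bound p0 K0 (walk_kernelD_ge gm nc K1 osc)
  (walk_kernel_trans gm nc tt) lam01 go (C0 n) (fun v w => sym v w n).
rewrite -/Q => pQ.
have D0 : (0 <= K ^+ 2 / (1 - lam) * Q)%R.
  by apply: mulr_ge0 => //; rewrite divr_ge0 ?sqr_ge0 ?(ltW d0).
have := sp _ _ D0 pQ; rewrite -(ler_pXn2r (n := 2))// ?nnegrE ?mulr_ge0 ?sqrtr_ge0 ?(ltW K0)//.
by rewrite exprMn sqr_sqrtr// !mulrA.
Unshelve. all: by end_near. Qed.
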